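(* Let $w$ be a weight on $T$. Then: (i) for every $p\in(1,\infty)$, $\mathcal M_\mu$ is bounded on $L^p_\mu(w)$ if and only if $w\in A_p(\mu)$; (ii) $\mathcal M_\mu$ is bounded from $L^1_\mu(w)$ to $L^{1,\infty}_\mu(w)$ if and only if $w\in A_1(\mu)$.
   Context: Tree and flow measure. $T$ is (the vertex set of) an infinite tree, i.e. an infinite connected graph with no loops; it is not assumed to be locally finite. $d$ is the geodesic distance and $x\sim y$ means $d(x,y)=1$. $\partial T$ is the boundary of $T$ (equivalence classes of semi-infinite geodesics, two being equivalent if they eventually coincide). Fix $\omega_*\in\partial T$; $[x,\omega_* )$ is the semi-infinite geodesic from $x$ to $\omega_*$, and $x\le y$ means $y\in[x,\omega_* )$. Fix $o\in T$, enumerate $[o,\omega_* )=\{x_j\}_{j\in\mathbb N}$ with $x_0=o$ and $d(x_j,x_k)=|j-k|$, and define the level $\ell(x)=\lim_{j\to\infty}(j-d(x,x_j))$. The set of successors of $x$ is $s(x)=\{y\sim x:\ell(y)=\ell(x)-1\}$. A flow measure is a positive function $\mu$ on $T$ with $\mu(x)=\sum_{y\in s(x)}\mu(y)$ for all $x\in T$; $\mu(E)=\sum_{y\in E}\mu(y)$. A flow measure $\mu$ is fixed (no doubling assumption). A weight is a positive function on $T$. Trapezoids. Fix a number $\beta\ge 12$. For $x\in T$ and $h_1,h_2\in\mathbb N$, $h_1<h_2$, the trapezoid with root $x$ and heights $h_1,h_2$ is $R_{h_1}^{h_2}(x)=\{y\in T: y\le x,\ h_1\le d(x,y)<h_2\}$.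 It is admissible if $2\le h_2/h_1\le\beta$ (so $h_1\ge1$). $\mathcal R$ is the family of all admissible trapezoids and all singletons. Weights. For a weight $w$ and $E\subset T$, $w_\mu(E)=\sum_{y\in E}w(y)\mu(y)$. For $p\in(1,\infty)$, $w\in A_p(\mu)$ means $$[w]_{A_p(\mu)}=\sup_{R\in\mathcal R}\Big(\frac1{\mu(R)}\sum_{y\in R}w(y)\mu(y)\Big)\Big(\frac1{\mu(R)}\sum_{y\in R}w(y)^{-1/(p-1)}\mu(y)\Big)^{p-1}<\infty,$$ and $w\in A_1(\mu)$ means $[w]_{A_1(\mu)}=\sup_{R\in\mathcal R}\frac{w_\mu(R)}{\mu(R)}\|w^{-1}\|_{L^\infty(R)}<\infty$. Maximal operator: $\mathcal M_\mu f(x)=\sup_{R\in\mathcal R,\ x\in R}\frac1{\mu(R)}\sum_{y\in R}|f(y)|\mu(y)$. The spaces $L^p_\mu(w)$ and $L^{p,\infty}_\mu(w)$ are the Lebesgue and weak Lebesgue spaces on $T$ with respect to the measure $w\mu$. *)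

(* Defs.v *)
From mathcomp Require Export all_boot all_order all_algebra.
From mathcomp Require Export all_classical all_reals all_analysis.
Export numFieldNormedType.Exports.

Set Implicit Arguments.
Unset Strict Implicit.
Unset Printing Implicit Defensive.

Export Order.TTheory GRing.Theory Num.Theory.

Local Open Scope classical_set_scope.
Local Open Scope ring_scope.

(* A "loop" is a cycle: in a simple graph, one through at least 3 distinct
   vertices (a cycle of size 2 runs back and forth along one edge).
   Vertices may have infinite degree. *)
Record tree := Tree {
  vertex :> choiceType ;
  adj : rel vertex ;
  adj_sym : symmetric adj ;
  adj_irr : irreflexive adj ;
  adj_connected :
    forall x y, exists2 s : seq vertex, path adj x s & last x s = y ;
  adj_acyclic : forall c : seq vertex, ucycle adj c -> (size c <= 2)%N ;
  vertex_infinite : ~ finite_set [set: vertex]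
}.

Definition walk_length (T : tree) (x y : T) : pred nat := fun n =>
  `[< exists s : seq T, [/\ path (@adj T) x s, last x s = y & size s = n] >].

Lemma walk_length_ex (T : tree) (x y : T) : exists n, walk_length x y n.
Proof.
have [s xs sy] := adj_connected x y.
by exists (size s); apply/asboolP; exists s.
Qed.

Definition dist (T : tree) (x y : T) : nat := ex_minn (walk_length_ex x y).

Definition geodesic_ray (T : tree) (g : nat -> T) : Prop :=
  forall j k : nat, dist (g j) (g k) = `|j%:Z - k%:Z|%N.

(* Rays eventually coincide up to a shift of the parameter. *)
Definition ray_equiv (T : tree) (g g' : nat -> T) : Prop :=
  exists m n : nat, forall k : nat, g (m + k)%N = g' (n + k)%N.

Definition boundary (T : tree) : set (set (nat -> T)) :=
  [set omega | exists2 g, geodesic_ray g &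
     omega = [set g' | geodesic_ray g' /\ ray_equiv g g']].
Arguments boundary : clear implicits.

(* The parametrized ray [x, omega); for omega in the boundary of a tree there
   is exactly one ray in omega with origin x, so the default value is unused. *)
Definition ray (T : tree) (omega : set (nat -> T)) (x : T) : nat -> T :=
  xget (fun=> x) [set g | omega g /\ g 0%N = x].

Definition below (T : tree) (omega : set (nat -> T)) (x y : T) : Prop :=
  range (ray omega x) y.

Definition level (R : realType) (T : tree) (omega : set (nat -> T)) (o x : T)
    : R :=
  limn (fun j : nat => j%:R - (dist x (ray omega o j))%:R : R).

Definition successors (R : realType) (T : tree) (omega : set (nat -> T))
    (o x : T) : set T :=
  [set y | adj y x /\ level R omega o y = level R omega o x - 1].

Definition weight (R : realType) (T : tree) (w : T -> R) : Prop :=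
  forall x, 0 < w x.

Definition flow_measure (R : realType) (T : tree) (omega : set (nat -> T))
    (o : T) (mu : T -> R) : Prop :=
  (forall x, 0 < mu x) /\
  (forall x, (mu x)%:E = \esum_(y in successors R omega o x) (mu y)%:E).

Definition mass (R : realType) (T : tree) (mu : T -> R) (E : set T) : \bar R :=
  \esum_(y in E) (mu y)%:E.

Definition trapezoid (T : tree) (omega : set (nat -> T)) (x : T)
    (h1 h2 : nat) : set T :=
  [set y | below omega y x /\ (h1 <= dist x y < h2)%N].

Definition admissible (R : realType) (beta : R) (h1 h2 : nat) : Prop :=
  [/\ (0 < h1)%N, (h1 < h2)%N & 2 <= (h2%:R / h1%:R : R) <= beta].

Definition trapezoids (R : realType) (T : tree) (omega : set (nat -> T))
    (beta : R) : set (set T) :=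
  [set E | (exists x h1 h2, admissible beta h1 h2 /\
              E = trapezoid omega x h1 h2)
        \/ (exists x, E = [set x])].

(* w_mu(E) / mu(E), for w >= 0.  Trapezoids may be infinite sets: their
   mu-mass is finite, but w_mu(E) may be +oo. *)
Definition mean (R : realType) (T : tree) (mu w : T -> R) (E : set T)
    : \bar R :=
  (mass (fun y => w y * mu y)%R E / mass mu E)%E.

Definition Ap_const (R : realType) (T : tree) (omega : set (nat -> T))
    (beta : R) (mu : T -> R) (p : R) (w : T -> R) : \bar R :=
  ereal_sup [set (mean mu w E *
                  mean mu (fun y => w y `^ (- (p - 1)^-1))%R E `^ (p - 1))%E
            | E in trapezoids omega beta].

(* norm of L^oo(E, mu): the essential supremum of |f| over E *)
Definition Linfty_norm (R : realType) (T : tree) (mu : T -> R) (E : set T)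
    (f : T -> R) : \bar R :=
  ereal_inf [set M%:E | M in
    [set M : R | 0 <= M /\ mass mu (E `&` [set y | M < `|f y|]) = 0%E]].

Definition A1_const (R : realType) (T : tree) (omega : set (nat -> T))
    (beta : R) (mu : T -> R) (w : T -> R) : \bar R :=
  ereal_sup [set (mean mu w E * Linfty_norm mu E (fun y => (w y)^-1)%R)%E
            | E in trapezoids omega beta].

Definition maximal (R : realType) (T : tree) (omega : set (nat -> T))
    (beta : R) (mu : T -> R) (f : T -> R) (x : T) : \bar R :=
  ereal_sup [set mean mu (fun y => `|f y|) E
            | E in [set E | trapezoids omega beta E /\ E x]].

(* Norms with respect to the measure with point masses nu y (nu = w * mu
   below); functions may take the value +oo, as maximal functions do. *)
Definition Lp_norm (R : realType) (T : tree) (nu : T -> R) (p : R)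
    (g : T -> \bar R) : \bar R :=
  ((\esum_(y in [set: T]) (`|g y| `^ p * (nu y)%:E)) `^ p^-1)%E.

Definition weak_Lp_norm (R : realType) (T : tree) (nu : T -> R) (p : R)
    (g : T -> \bar R) : \bar R :=
  ereal_sup [set (t%:E * mass nu [set y | t%:E < `|g y|] `^ p^-1)%E
            | t in [set t : R | 0 < t]].

Definition strong_bounded (R : realType) (T : tree) (nu : T -> R) (p : R)
    (S : (T -> R) -> T -> \bar R) : Prop :=
  exists2 C : R, 0 <= C & forall f : T -> R,
    (Lp_norm nu p (EFin \o f) < +oo)%E ->
    (Lp_norm nu p (S f) <= C%:E * Lp_norm nu p (EFin \o f))%E.

Definition weak_bounded (R : realType) (T : tree) (nu : T -> R) (p : R)
    (S : (T -> R) -> T -> \bar R) : Prop :=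
  exists2 C : R, 0 <= C & forall f : T -> R,
    (Lp_norm nu p (EFin \o f) < +oo)%E ->
    (weak_Lp_norm nu p (S f) <= C%:E * Lp_norm nu p (EFin \o f))%E.

(* Main.v *)
Require Import Defs.
From mathcomp Require Import zify ring lra.

Set Implicit Arguments.
Unset Strict Implicit.
Unset Printing Implicit Defensive.

Local Open Scope classical_set_scope.
Local Open Scope ring_scope.

(** Sending a vertex to its neighbour in the direction of the end orders the
    tree by generations: a trapezoid consists of the descendants of its root in
    the generations from [h1] to [h2 - 1], counted from the root, and, the flow
    being preserved from one generation to the next, its measure is [h2 - h1]
    times the measure of the root.

    Necessity is tested on one trapezoid [Q] at a time, with the function equal
    to the dual weight [w `^ (- 1 / (p - 1))] on a finite part of [Q] when
    [p > 1] ([Ap_necessary]), and with the indicator function of a point when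
    [p = 1] ([A1_necessary]).

    For sufficiency, the basic fact is a covering property: if two trapezoids
    meet, then the one with the lower root is inside a dilate of the other one,
    in which the root is kept and the range of heights is enlarged by a bounded
    factor ([trap_covering]). The measure [mu] itself may be non-doubling, but
    only heights are dilated here, never roots. If [w] is a Muckenhoupt weight,
    [w mu] of the dilate is controlled by [w mu] of the trapezoid, by moving a
    dyadic window of heights a bounded number of times ([mass_dilate]). Hence,
    for [nu] equal to [w mu], or to [s mu] with [s] the dual weight, the maximal
    function [M_nu], with averages taken with respect to [nu], is of weak type
    (1, 1) for [nu] ([weak_type]), and bounded on [L^q(nu)] for all [q > 1] by
    interpolation ([interpolation]).

    For [p = 1] one concludes with [M f <= K M_nu f]. For [p > 1], reverse
    Hoelder inequalities are avoided by means of the pointwise domination of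
    Lerner ([max_function_dominated])
      [(M f) ^ (p - 1) <= K M_{w mu} (M_{s mu} (f / s) ^ (p - 1) / w)],
    followed by the bounds of [M_{w mu}] with exponent [p / (p - 1)] and of
    [M_{s mu}] with exponent [p] ([Ap_sufficient]). *)

(** * Distances and geodesics in a tree *)

Section Distance.
Context (T : tree).
Implicit Types (x y z : T) (g h : nat -> T).

Lemma dist_path x y :
  exists s : seq T, [/\ path (@adj T) x s, last x s = y & size s = dist x y].
Proof. by rewrite /dist; case: ex_minnP => n /asboolP. Qed.

Lemma dist_le_path x (s : seq T) :
  path (@adj T) x s -> (dist x (last x s) <= size s)%N.
Proof.
move=> xs; rewrite /dist; case: ex_minnP => n _; apply.
by apply/asboolP; exists s.
Qed.

Lemma distxx x : dist x x = 0%N.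
Proof. by apply/eqP; rewrite -leqn0 (@dist_le_path x [::]). Qed.

Lemma dist_eq0 x y : dist x y = 0%N -> x = y.
Proof. by have [[|a s] [_ sy sz]] := dist_path x y; rewrite -sz. Qed.

Lemma distC x y : dist x y = dist y x.
Proof.
suff le (u v : T) : (dist u v <= dist v u)%N by apply/eqP; rewrite eqn_leq !le.
have [s [vs su <-]] := dist_path v u.
have rvs : path (@adj T) u (rev (belast v s)).
  rewrite -su rev_path.
  by apply: sub_path vs => a b; rewrite adj_sym.
have := dist_le_path rvs; rewrite size_rev size_belast.
suff -> : last u (rev (belast v s)) = v by [].
by case: (s) su => [//|a s'] /= _; rewrite rev_cons last_rcons.
Qed.

Lemma dist_triangle y x z : (dist x z <= dist x y + dist y z)%N.
Proof.
have [s [xs sy <-]] := dist_path x y; have [s' [ys sz <-]] := dist_path y z.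
rewrite -size_cat -sz -sy -last_cat; apply: dist_le_path.
by rewrite cat_path xs sy.
Qed.

Lemma adj_dist x y : adj x y -> dist x y = 1%N.
Proof.
move=> xy; apply/eqP; rewrite eqn_leq; apply/andP; split.
  by apply: (@dist_le_path x [:: y]); rewrite /= xy.
rewrite lt0n; apply/eqP => /dist_eq0 xy0.
by move: xy; rewrite xy0 adj_irr.
Qed.

Lemma dist_adj x y : dist x y = 1%N -> adj x y.
Proof.
have [[|a [|b s]] [xs sy sz]] := dist_path x y; rewrite -sz//= => _.
by move: xs sy => /= /andP[xa _] <-.
Qed.

(** Consecutive vertices of a ray are adjacent, and this together with being
    at distance [k] from the origin at time [k], infinitely often, already
    forces every sub-segment to be as long as possible. *)
Lemma geodesic_rayP g : (forall k, adj (g k) (g k.+1)) ->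
  (forall N : nat, exists2 k, (N <= k)%N & dist (g 0%N) (g k) = k) ->
  geodesic_ray g.
Proof.
move=> gadj gfar.
have step j n : (dist (g j) (g (j + n)%N) <= n)%N.
  elim: n => [|n IH]; first by rewrite addn0 distxx.
  apply: leq_trans (dist_triangle (g (j + n)%N) _ _) _.
  by rewrite addnS (adj_dist (gadj _)) addn1 ltnS.
have main j n : dist (g j) (g (j + n)%N) = n.
  apply/eqP; rewrite eqn_leq step /=.
  have [k jnk kE] := gfar (j + n)%N.
  have h1 := step 0%N j; have h2 := step (j + n)%N (k - (j + n))%N.
  have h3 := dist_triangle (g j) (g 0%N) (g k).
  have h4 := dist_triangle (g (j + n)%N) (g j) (g k).
  by rewrite add0n in h1; rewrite subnKC // in h2; lia.
move=> j k; case: (leqP j k) => jk.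
  by rewrite -{1}(subnKC jk) main; lia.
by rewrite distC -{1}(subnKC (ltnW jk)) main; lia.
Qed.

Lemma geodesic_ray_adj g k : geodesic_ray g -> adj (g k) (g k.+1).
Proof. by move=> gg; apply: dist_adj; rewrite gg; lia. Qed.

Lemma geodesic_dist0 g k : geodesic_ray g -> dist (g 0%N) (g k) = k.
Proof. by move=> gg; rewrite gg; lia. Qed.

Definition segment (m : nat) (g : nat -> T) :=
  forall i j, (i <= m)%N -> (j <= m)%N -> dist (g i) (g j) = `|i%:Z - j%:Z|%N.

Lemma path_map_iota (a : nat -> T) i m :
  (forall k, (i <= k < i + m)%N -> adj (a k) (a k.+1)) ->
  path (@adj T) (a i) (map a (iota i.+1 m)).
Proof.
elim: m i => //= m IH i h; rewrite h /= ?IH //; last by lia.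
by move=> k hk; apply: h; lia.
Qed.

(** Cut both geodesics at a vertex that they share; in the end they have only
    their endpoints in common and would, when glued, be a cycle. *)
Lemma segment_uniq m (a b : nat -> T) : segment m a -> segment m b ->
  a 0%N = b 0%N -> a m = b m -> forall i, (i <= m)%N -> a i = b i.
Proof.
elim/ltn_ind: m a b => m IH a b sa sb ab0 abm i im.
have [[j [j0 jm abj]]|nomeet] :=
    pselect (exists j, [/\ (0 < j)%N, (j < m)%N & a j = b j]).
  have [ij|ji] := leqP i j.
    by apply: (IH j jm) => // k l kj lj; [apply: sa|apply: sb]; lia.
  have shifted : forall k, (k <= m - j)%N -> a (j + k)%N = b (j + k)%N.
    apply: (IH (m - j)%N _ (fun k => a (j + k)%N) (fun k => b (j + k)%N)).
    - by lia.
    - by move=> k l kj lj; rewrite sa; lia.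
    - by move=> k l kj lj; rewrite sb; lia.
    - by rewrite addn0.
    - by rewrite subnKC // ltnW.
  by rewrite -(subnKC (ltnW ji)); apply: shifted; lia.
have [m1|m1] := leqP m 1.
  case: i im => [//|i] im; have -> : i.+1 = m by lia.
  by [].
pose b' k := b (m - k)%N.
pose c := a 0%N :: map a (iota 1 m) ++ map b' (iota 1 m.-1).
have adja k : (k < m)%N -> adj (a k) (a k.+1).
  by move=> km; apply: dist_adj; rewrite sa; lia.
have adjb k : (k < m)%N -> adj (b' k) (b' k.+1).
  by move=> km; apply: dist_adj; rewrite sb; lia.
have am : last (a 0%N) (map a (iota 1 m)) = a m.
  by rewrite last_map -nth_last size_iota nth_iota; [congr a; lia|lia].
suff /adj_acyclic : ucycle (@adj T) c.
  by rewrite /c /= size_cat !size_map !size_iota; lia.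
apply/andP; split.
  rewrite /cycle /c rcons_cat.
  have -> : rcons (map b' (iota 1 m.-1)) (a 0%N) = map b' (iota 1 m).
    have -> : a 0%N = b' m by rewrite /b' subnn ab0.
    rewrite -map_rcons; congr (map _ _).
    case: (m) m1 => [//|m'] _; rewrite -(addn1 m') iotaD addn1 cats1.
    by rewrite add1n.
  rewrite cat_path; apply/andP; split.
    by apply: path_map_iota => k ?; apply: adja; lia.
  rewrite am abm; have -> : b m = b' 0%N by rewrite /b' subn0.
  by apply: path_map_iota => k ?; apply: adjb; lia.
rewrite /c -cat_cons -[a 0%N :: map a (iota 1 m)]/(map a (iota 0 m.+1)).
rewrite cat_uniq; apply/and3P; split.
- rewrite map_inj_in_uniq ?iota_uniq // => k l; rewrite !mem_iota => hk hl.
  by move=> akl; have := sa k l; rewrite akl distxx; lia.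
- apply/hasPn => z /mapP[k]; rewrite mem_iota => hk ->.
  apply/negP => /mapP[l]; rewrite mem_iota => hl bal.
  have e1 : dist (b 0%N) (b' k) = (m - k)%N by rewrite sb; lia.
  have e2 : dist (a 0%N) (a l) = l by rewrite sa; lia.
  have lE : l = (m - k)%N by rewrite -e2 -bal ab0.
  by apply: nomeet; exists l; split; [lia|lia|rewrite -bal /b' lE].
- rewrite map_inj_in_uniq ?iota_uniq // => k l; rewrite !mem_iota => hk hl.
  by move=> akl; have := sb (m - k)%N (m - l)%N; rewrite -/(b' k) akl distxx; lia.
Qed.

End Distance.

(** * The end and the parent map *)

Section Boundary.
Context (T : tree) (omega : set (nat -> T)).
Hypothesis homega : boundary T omega.
Implicit Types (x y z : T) (g h : nat -> T).

Lemma end_geodesic g : omega g -> geodesic_ray g.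
Proof. by case: homega => g0 _ -> []. Qed.

Lemma end_equiv g h : omega g -> omega h -> ray_equiv g h.
Proof.
case: homega => g0 _ -> [_ [m [n gE]]] [_ [m' [n' hE]]].
exists (n + m')%N, (n' + m)%N => k.
by rewrite -!addnA -gE -hE; congr g0; lia.
Qed.

Lemma end_closed g h : omega g -> geodesic_ray h -> ray_equiv g h -> omega h.
Proof.
case: homega => g0 _ -> [_ [m [n gE]]] hh [m' [n' hE]]; split=> //.
exists (m + m')%N, (n' + n)%N => k.
rewrite -(addnA n') -hE (_ : m' + (n + k) = n + (m' + k))%N; last by lia.
by rewrite -gE addnA.
Qed.

(** The distance from [x] to [g j] grows by at most one at each step, and its
    deficit from [j] is bounded by the triangle inequality, so that from some
    index on it grows by exactly one: from there on [g] leads straight away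
    from [x]. *)
Lemma eventually_straight g x : geodesic_ray g ->
  exists m, forall k, dist x (g (m + k)%N) = (dist x (g m) + k)%N.
Proof.
move=> gg.
pose e j := (dist x (g 0%N) + j - dist x (g j))%N.
have step j k : (dist x (g (j + k)%N) <= dist x (g j) + k)%N.
  apply: leq_trans (dist_triangle (g j) _ _) _; rewrite leq_add2l.
  by rewrite gg; lia.
have ebound j : (e j <= 2 * dist x (g 0%N))%N.
  have := dist_triangle x (g 0%N) (g j); rewrite (distC _ x) gg /e; lia.
have [m mmax] : exists m, forall j, (e j <= e m)%N.
  have exE : exists n, `[< exists j, e j = n >].
    by exists (e 0%N); apply/asboolP; exists 0%N.
  have [|n /asboolP[m <-] h] := @ex_maxnP _ (2 * dist x (g 0%N)) exE.
    by move=> n /asboolP[j <-].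
  by exists m => j; apply: h; apply/asboolP; exists j.
exists m => k; have := mmax (m + k)%N; have := step m k.
by have := step 0%N m; have := step 0%N (m + k)%N; rewrite /e !add0n; lia.
Qed.

(** A shortest path from [x] to a vertex where a ray of the end leads straight
    away from [x], continued by that ray, is a ray. *)
Lemma end_ray_exists x : exists g, omega g /\ g 0%N = x.
Proof.
have [g og] : exists g, omega g.
  by case: homega => g gg ->; exists g; split => //; exists 0%N, 0%N.
have gg := end_geodesic og.
have [m mE] := eventually_straight x gg.
have [s [xs sg sz]] := dist_path x (g m).
pose n := size s.
pose h i := if (i <= n)%N then nth x (x :: s) i else g (m + (i - n))%N.
have hn k : h (n + k)%N = g (m + k)%N.
  rewrite /h; case: leqP => nk; last by congr g; lia.
  have -> : k = 0%N by lia.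
  by rewrite !addn0 -sg -nth_last /= /n; case: (s).
have h0 : h 0%N = x by [].
exists h; split=> //; apply: end_closed og _ _; last by exists m, n.
apply: geodesic_rayP => [k|N].
  have [kn|kn] := ltnP k n.
    by rewrite /h kn (ltnW kn); exact: (pathP x xs).
  rewrite -(subnKC kn) -addnS !hn addnS.
  exact: geodesic_ray_adj.
by exists (n + N)%N; rewrite ?leq_addl // hn h0 mE -sz.
Qed.

(** With a common origin, the parameter is the distance from the origin: two
    such rays merge without a shift, and geodesics to the merging point are
    unique. *)
Lemma end_ray_uniq g h : omega g -> omega h -> g 0%N = h 0%N -> g = h.
Proof.
move=> og oh gh0; have [m [n mnE]] := end_equiv og oh.
have gg := end_geodesic og; have gh := end_geodesic oh.
have mn : m = n.
  have := mnE 0%N; rewrite !addn0 => e.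
  by rewrite -(geodesic_dist0 m gg) -(geodesic_dist0 n gh) gh0 e.
rewrite {}mn in mnE *; apply/funext => k.
have seg (f : nat -> T) : geodesic_ray f -> segment (n + k) f.
  by move=> ff i j _ _; exact: ff.
exact: (segment_uniq (seg _ gg) (seg _ gh) gh0 (mnE k) (leq_addl n k)).
Qed.

Lemma rayP x : omega (ray omega x) /\ ray omega x 0%N = x.
Proof. exact: (xgetPex _ (end_ray_exists x)). Qed.

Lemma ray_unique g : omega g -> ray omega (g 0%N) = g.
Proof. by move=> og; have [or r0] := rayP (g 0%N); exact: end_ray_uniq. Qed.

(** The neighbour of a vertex in the direction of the end: ascending along the
    end is iterating this map, which is all that is used of the tree later. *)
Definition parent x : T := ray omega x 1.

Lemma end_shift g n : omega g -> omega (fun k => g (n + k)%N).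
Proof.
move=> og; apply: (end_closed og); last by exists n, 0%N.
by move=> j k; rewrite (end_geodesic og); lia.
Qed.

Lemma ray_iter x k : ray omega x k = iter k parent x.
Proof.
elim: k x => [|k IH] x; first by have [_] := rayP x.
rewrite iterSr -IH /parent.
have [ox _] := rayP x; have := ray_unique (end_shift 1 ox).
by rewrite addn0 => ->.
Qed.

Lemma dist_iter_parent x k : dist (iter k parent x) x = k.
Proof.
have [ox x0] := rayP x.
by rewrite -ray_iter distC -{1}x0 (geodesic_dist0 _ (end_geodesic ox)).
Qed.

Lemma iter_parent_inj x j k : iter j parent x = iter k parent x -> j = k.
Proof. by move=> e; rewrite -(dist_iter_parent x j) e dist_iter_parent. Qed.

Section Level.
Context (R : realType) (o : T).
Local Notation lev := (level R omega o).

(** The rays of [x] and [o] merge; the lag between them is the level. *)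
Lemma ray_merge x : exists mn : nat * nat,
  forall k, iter (mn.1 + k)%N parent x = ray omega o (mn.2 + k)%N.
Proof.
have [ox _] := rayP x; have [oo _] := rayP o.
have [m [n mnE]] := end_equiv ox oo; exists (m, n) => k.
by rewrite -ray_iter mnE.
Qed.

Lemma level_merge x m n :
  (forall k, iter (m + k)%N parent x = ray omega o (n + k)%N) ->
  lev x = n%:R - m%:R.
Proof.
move=> mnE; apply: cvg_lim => //; apply: cvg_near_cst.
exists n => // j /= nj.
rewrite -{2}(subnKC nj) -mnE distC dist_iter_parent -{1}(subnKC nj) !natrD.
by ring.
Qed.

Lemma level_parent x : lev (parent x) = lev x + 1.
Proof.
have [[m n] /= mnE] := ray_merge x.
rewrite (level_merge mnE) (@level_merge (parent x) m n.+1); last first.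
  by move=> k; rewrite -iterSr -addnS mnE addSnnS.
by rewrite -natr1; ring.
Qed.

Lemma level_iter_parent x k : lev (iter k parent x) = lev x + k%:R.
Proof.
elim: k => [|k IH] /=; first by rewrite addr0.
by rewrite level_parent IH -natr1 addrA.
Qed.

(** If [y ~ x] has level one less, then [y] is one step further than [x] from
    the far vertices of the end, so that [y] followed by the ray of [x] is the
    ray of [y]. *)
Lemma successorsE x : successors R omega o x = [set y | parent y = x].
Proof.
apply/seteqP; split=> y /=; last first.
  move=> <-; split; last by rewrite level_parent addrK.
  by apply: dist_adj; rewrite distC (dist_iter_parent y 1).
move=> [yx levE].
have [[m n] /= mnE] := ray_merge x; have [[m' n'] /= mnE'] := ray_merge y.
have mnn : (n' + m.+1 = n + m')%N.
  apply/eqP; rewrite -(eqr_nat R); apply/eqP.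
  move: levE; rewrite (level_merge mnE) (level_merge mnE') !natrD -natr1.
  by move=> e; lra.
have [ox x0] := rayP x.
pose h k := if k is k'.+1 then ray omega x k' else y.
suff oh : omega h by rewrite /parent -[y]/(h 0%N) ray_unique.
apply: (end_closed ox); last by exists 0%N, 1%N.
apply: geodesic_rayP => [[|k]|N] /=.
- by rewrite x0.
- exact: geodesic_ray_adj (end_geodesic ox).
- exists (m + n' + N).+1 => /=; first by lia.
  rewrite ray_iter -addnA mnE (_ : n + (n' + N) = n' + (n + N))%N; last by lia.
  by rewrite -mnE' distC dist_iter_parent; lia.
Qed.

End Level.

Lemma trapezoidE x (h1 h2 : nat) : trapezoid omega x h1 h2 =
  [set y | exists2 k, (h1 <= k < h2)%N & iter k parent y = x].
Proof.
apply/seteqP; split=> y /=.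
  move=> [[k _ kx]]; rewrite -kx ray_iter dist_iter_parent => kh.
  by exists k.
move=> [k kh kx]; split; last by rewrite -kx dist_iter_parent.
by exists k => //; rewrite ray_iter.
Qed.

End Boundary.

(** * Sums of nonnegative terms *)

Section SumsOfNonnegativeTerms.
Context (R : realType).
Local Open Scope ereal_scope.

Lemma lt_pdive (t a b : \bar R) : 0 < b -> b < +oo -> (t < a / b) = (t * b < a).
Proof.
move: b => [b| |] //; rewrite lte_fin => b0 _.
by rewrite inver gt_eqF// lte_pdivlMr.
Qed.

Lemma le_poweR (r : R) (x y : \bar R) : (0 <= r)%R -> 0 <= x -> x <= y ->
  x `^ r <= y `^ r.
Proof.
move=> r0 x0 xy; apply: gt0_ler_poweR => //; rewrite in_itv /= leey andbT//.
exact: le_trans xy.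
Qed.

Lemma le_esum_set (I : choiceType) (A B : set I) (a : I -> \bar R) :
  A `<=` B -> (forall i, B i -> 0 <= a i) ->
  \esum_(i in A) a i <= \esum_(i in B) a i.
Proof.
move=> AB a0; apply: ereal_sup_le => _ [X [finX XA] <-].
by exists X => //; split=> // i /XA /AB.
Qed.

Lemma le_esumU (I : choiceType) (A B : set I) (a : I -> \bar R) :
  (forall i, 0 <= a i) ->
  \esum_(i in A `|` B) a i <= \esum_(i in A) a i + \esum_(i in B) a i.
Proof.
move=> a0; rewrite (esumID A)//; apply: leeD.
  by apply: le_esum_set => // i [].
by apply: le_esum_set => // i [[]].
Qed.

Lemma esumU (I : choiceType) (A B : set I) (a : I -> \bar R) :
  (forall i, 0 <= a i) -> A `&` B = set0 ->
  \esum_(i in A `|` B) a i = \esum_(i in A) a i + \esum_(i in B) a i.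
Proof.
move=> a0 AB0; rewrite (esumID A)//; congr (_ + _); congr esum.
  by apply/seteqP; split=> i; [case|move=> Ai; split=> //; left].
apply/seteqP; split=> i; first by case=> -[].
move=> Bi; split; first by right.
by move=> Ai; have : (A `&` B) i by []; rewrite AB0.
Qed.

Lemma ge_esum_point (I : choiceType) (A : set I) (a : I -> \bar R) i : A i ->
  (forall j, 0 <= a j) -> a i <= \esum_(j in A) a j.
Proof.
by move=> Ai a0; rewrite -[leLHS](@esum_set1 R I i a)//; apply: le_esum_set => // j ->.
Qed.

Lemma esumZl (I : choiceType) (A : set I) (a : I -> \bar R) (c : R) :
  (0 <= c)%R -> (forall i, A i -> 0 <= a i) ->
  \esum_(i in A) (c%:E * a i) = c%:E * \esum_(i in A) a i.
Proof.
rewrite le_eqVlt => /predU1P[<- a0|c0 a0].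
  by rewrite mul0e; apply: esum1 => i _; rewrite mul0e.
have sumZ X : fsets A X ->
    \sum_(i \in X) (c%:E * a i) = c%:E * \sum_(i \in X) a i.
  move=> [finX XA]; rewrite !fsbig_finite//= big_seq [in RHS]big_seq.
  rewrite ge0_sume_distrr// => i.
  by rewrite in_fset_set// inE => /XA; exact: a0.
rewrite /esum -ereal_sup_pZl//; congr ereal_sup; apply/seteqP; split.
  by move=> _ [X XA <-]; exists (\sum_(i \in X) a i); [exists X|rewrite sumZ].
by move=> _ [_ [X XA <-] <-]; exists X => //; rewrite sumZ.
Qed.

Lemma esum_exchange (I J : choiceType) (A : set I) (B : set J)
    (a : I -> J -> \bar R) : (forall i j, 0 <= a i j) ->
  \esum_(i in A) \esum_(j in B) a i j = \esum_(j in B) \esum_(i in A) a i j.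
Proof.
move=> a0; rewrite !esum_esum//.
rewrite (reindex_esum (B `*` A) _ (fun z => (z.2, z.1)))//; split=> //=.
- by move=> [j i] [/=].
- by move=> [i1 i2] [j1 j2] /= _ _ [] -> ->.
- by move=> [i j] [Ai Bj] /=; exists (j, i).
Qed.

Lemma esum_fibers (I J : choiceType) (A : set I) (B : set J) (f : J -> I)
    (a : J -> \bar R) : (forall j, 0 <= a j) -> (forall j, B j -> A (f j)) ->
  \esum_(j in B) a j = \esum_(i in A) \esum_(j in B `&` [set j | f j = i]) a j.
Proof.
move=> a0 fBA; rewrite esum_esum//.
rewrite (reindex_esum B _ (fun j => (f j, j)))//; split=> //=.
- by move=> j Bj; split=> //=; exact: fBA.
- by move=> j1 j2 /= _ _ [].
- by move=> [i j] [/= Ai [Bj <-]]; exists j.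
Qed.

End SumsOfNonnegativeTerms.

(** * The weak type inequality for a covering basis *)

Section CoveringBasis.
Context (R : realType) (T : choiceType) (I : eqType).
Context (ok : set I) (A S : I -> set T) (rank : I -> R) (nu : T -> R) (K : R).
Local Open Scope ereal_scope.

Local Notation msr E := (\esum_(y in E) (nu y)%:E).
Local Notation integ g E := (\esum_(y in E) (g y * (nu y)%:E)).

(** Averages are taken with respect to [nu] itself; the values of [g] may be
    infinite because [g] is itself built from maximal functions later. *)
Definition max_function (g : T -> \bar R) (x : T) : \bar R :=
  ereal_sup [set integ g (A i) / msr (A i) | i in [set i | ok i /\ A i x]].

Hypothesis nu_gt0 : forall x, (0 < nu x)%R.
Hypothesis A_neq0 : forall i, ok i -> A i !=set0.
Hypothesis A_fin : forall i, ok i -> msr (A i) < +oo.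
Hypothesis covering : forall i j, ok i -> ok j -> (rank j <= rank i)%R ->
  A i `&` A j !=set0 -> A j `<=` S i.
Hypothesis K_ge0 : (0 <= K)%R.
Hypothesis dilation : forall i, ok i -> msr (S i) <= K%:E * msr (A i).

Let nu_ge0 x : 0 <= (nu x)%:E. Proof. by rewrite lee_fin ltW. Qed.
Let integ_ge0 g E : (forall x, 0 <= g x) -> 0 <= integ g E.
Proof. by move=> g0; apply: esum_ge0 => x _; rewrite mule_ge0. Qed.
Let A_gt0 i : ok i -> 0 < msr (A i).
Proof.
move=> /A_neq0[x Ax]; apply: lt_le_trans (ge_esum_point Ax _) => //.
by rewrite lte_fin.
Qed.

(** A set of largest rank swallows, after dilation, all the sets that meet it,
    and the remaining ones are disjoint from it: so the bound for the latter
    can be added to the bound for the former. *)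
Lemma vitali_selection (g : T -> \bar R) (t : R) (s : seq I) :
  (forall x, 0 <= g x) -> (0 <= t)%R ->
  (forall i, i \in s -> ok i /\ t%:E * msr (A i) <= integ g (A i)) ->
  t%:E * msr (\bigcup_(i in [set` s]) A i) <=
  K%:E * integ g (\bigcup_(i in [set` s]) A i).
Proof.
move=> g0 t0; have [n] := ubnP (size s).
elim: n s => [//|n IH] s sn hs; set U := \bigcup_(i in [set` s]) A i.
have [s0|[i0 i0s]] : s = [::] \/ exists i, i \in s.
  by case: (s) => [|i ?]; [left|right; exists i; rewrite mem_head].
  rewrite (_ : U = set0) ?esum_set0 ?mule0 //.
  by rewrite /U s0; apply/seteqP; split => x // [].
have [i is_ imax] : exists2 i, i \in s & forall j, j \in s -> (rank j <= rank i)%R.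
  elim: (s) i0 i0s => // a r IHr _ _.
  have [r0|[j jr]] : r = [::] \/ exists i, i \in r.
    by case: (r) => [|j ?]; [left|right; exists j; rewrite mem_head].
    by exists a; rewrite ?mem_head// r0 => j; rewrite inE => /eqP->.
  have [i ir imax] := IHr _ jr.
  have [ai|/ltW ia] := leP (rank a) (rank i).
    by exists i => [|k]; rewrite inE ?ir ?orbT// => /predU1P[->|/imax].
  exists a => [|k]; rewrite ?mem_head// inE => /predU1P[->//|/imax ki].
  exact: le_trans ia.
have [oki hi] := hs _ is_.
pose s' := [seq j <- s | ~~ `[< A i `&` A j !=set0 >]].
pose U' := \bigcup_(j in [set` s']) A j.
have IHs' : t%:E * msr U' <= K%:E * integ g U'.
  apply: IH; last by move=> j; rewrite mem_filter => /andP[_ /hs].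
  rewrite -ltnS; apply: leq_trans sn; rewrite ltnS size_filter.
  rewrite -(count_predC [pred j | ~~ `[< A i `&` A j !=set0 >]] s).
  rewrite -[ltnLHS]addn0 ltn_add2l -has_count; apply/hasP; exists i => //=.
  by rewrite negbK; apply/asboolP; have [x] := A_neq0 oki; exists x.
have US : U `<=` S i `|` U'.
  move=> x [j /= js Ajx]; have [mt|nmt] := pselect (A i `&` A j !=set0).
    by left; apply: covering Ajx => //; [have [] := hs _ js|exact: imax].
  by right; exists j => //=; rewrite mem_filter js andbT; apply/asboolPn.
have AU' : A i `&` U' = set0.
  apply/seteqP; split=> // x [Aix [j /=]].
  by rewrite mem_filter => /andP[/asboolPn + _] Ajx; apply; exists x.
have AUU : A i `|` U' `<=` U.
  move=> x [Aix|[j /=]]; first by exists i.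
  by rewrite mem_filter => /andP[_ js] Ajx; exists j.
have mU : msr U <= msr (S i) + msr U'.
  by apply: le_trans (le_esumU _ _ _) => //; apply: le_esum_set.
apply: le_trans (lee_wpmul2l _ mU) _; first by rewrite lee_fin.
rewrite ge0_muleDr; [|exact: esum_ge0..].
apply: (@le_trans _ _ (K%:E * integ g (A i `|` U'))); last first.
  apply: lee_wpmul2l; first by rewrite lee_fin.
  by apply: le_esum_set => // x _; rewrite mule_ge0.
rewrite esumU//; last by move=> x; rewrite mule_ge0.
rewrite ge0_muleDr; [|exact: integ_ge0..].
apply: leeD => //; apply: le_trans (lee_wpmul2l _ (dilation oki)) _.
  by rewrite lee_fin.
by rewrite muleCA; apply: lee_wpmul2l; rewrite ?lee_fin.
Qed.

(** The mass of the superlevel set is a supremum over finite subsets, so that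
    finitely many sets of the basis are enough to cover. *)
Lemma weak_type (g : T -> \bar R) (t : R) : (forall x, 0 <= g x) -> (0 <= t)%R ->
  t%:E * msr [set x | t%:E < max_function g x] <= K%:E * integ g setT.
Proof.
move=> g0 t0; rewrite -esumZl//; apply: ge_ereal_sup => _ [X [finX XM] <-].
have [s Xs hs] : exists2 s : seq I, X `<=` \bigcup_(i in [set` s]) A i &
    forall i, i \in s -> ok i /\ t%:E * msr (A i) <= integ g (A i).
  have wit x : X x -> exists i, [/\ ok i, A i x & t%:E * msr (A i) <= integ g (A i)].
    move=> /XM /ereal_sup_gt[_ [i [oki Aix] <-]].
    rewrite lt_pdive; [|exact: A_gt0|exact: A_fin] => /ltW ti.
    by exists i.
  have [F XF] : exists F : seq T, forall x, X x <-> x \in F.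
    by have /finite_seqP[F XE] := finX; exists F => x; rewrite XE.
  have {}wit x : x \in F ->
      exists i, [/\ ok i, A i x & t%:E * msr (A i) <= integ g (A i)].
    by move=> /XF; exact: wit.
  suff [s Fs hs] : exists2 s : seq I, (forall x, x \in F -> exists2 i, i \in s & A i x) &
      forall i, i \in s -> ok i /\ t%:E * msr (A i) <= integ g (A i).
    by exists s => // x /XF /Fs[i]; exists i.
  elim: F wit {XF} => [|x F IH] wit; first by exists [::].
  have [i [oki Aix ti]] := wit x (mem_head _ _).
  have [|s Fs hs] := IH.
    by move=> y Fy; apply: wit; rewrite inE Fy orbT.
  exists (i :: s) => [y|j].
    rewrite inE => /predU1P[->|/Fs[j js Ajy]]; first by exists i; rewrite ?mem_head.
    by exists j; rewrite // inE js orbT.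
  by rewrite inE => /predU1P[->|/hs].
apply: le_trans (le_trans (vitali_selection g0 t0 hs) _); last first.
  apply: lee_wpmul2l; first by rewrite lee_fin.
  by apply: le_esum_set => // x _; rewrite mule_ge0.
rewrite -esumZl//.
apply: esum_ge; exists X => //.
Qed.

(** The part of [g] below [t] adds at most [t] to the averages. *)
Lemma weak_type_above (g : T -> \bar R) (t : R) :
  (forall x, 0 <= g x) -> (0 <= t)%R ->
  t%:E * msr [set x | (2 * t)%:E < max_function g x] <=
  K%:E * integ g [set y | t%:E < g y].
Proof.
move=> g0 t0; pose g1 y := if y \in [set y | t%:E < g y] then g y else 0.
have g10 y : 0 <= g1 y by rewrite /g1; case: ifP.
have -> : integ g [set y | t%:E < g y] = integ g1 setT.
  rewrite esum_mkcond; apply: eq_esum => y _; rewrite /g1.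
  by case: ifP; rewrite // mul0e.
apply: le_trans (weak_type g10 t0); apply: lee_wpmul2l; first by rewrite lee_fin.
apply: le_esum_set => // x /= /ereal_sup_gt[_ [i [oki Aix] <-]].
have [A0 Aoo] := (A_gt0 oki, A_fin oki).
rewrite lt_pdive// => ti; apply/ereal_sup_gtP.
exists (integ g1 (A i) / msr (A i)); first by exists i.
rewrite lt_pdive//.
have gg1 : integ g (A i) <= integ g1 (A i) + t%:E * msr (A i).
  rewrite -esumZl// -esumD; [|by move=> y _; rewrite mule_ge0..].
  apply: le_esum => y _; rewrite -ge0_muleDl//; apply: lee_wpmul2r => //.
  rewrite /g1; case: ifPn; rewrite ?in_setE; first by rewrite leeDl.
  by rewrite notin_setE /= add0e => /negP; rewrite -leNgt.
have tA : t%:E * msr (A i) \is a fin_num.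
  by rewrite ge0_fin_numE ?mule_ge0 ?(ltW A0)// lte_mul_pinfty.
rewrite -(lteD2rE _ _ tA); apply: lt_le_trans gg1.
by rewrite -ge0_muleDl// -EFinD -mulr2n -mulr_natl.
Qed.
End CoveringBasis.

(** * Layer cake sums and interpolation *)

Section LayerCake.
Context (R : realType).
Local Open Scope ereal_scope.

(** The integers [k] are those below [ln s], and the terms decrease
    geometrically from the largest such [k] downwards. *)
Lemma layer_cake_geometric (r s : R) : (0 < r)%R -> (0 < s)%R ->
  \esum_(k in [set k : int | (expR k%:~R < s)%R]) (expR (k%:~R * r))%:E <=
  ((1 - expR (- r))^-1 * s `^ r)%:E.
Proof.
move=> r0 s0; pose m := Num.floor (ln s).
have z0 := expR_gt0 (- r).
have z1 : (expR (- r) < 1)%R by rewrite -expR0 ltr_expR oppr_lt0.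
have sub : [set k : int | (expR k%:~R < s)%R] `<=` [set k | (k <= m)%R].
  move=> k /= ks; rewrite floor_ge_int.
  by rewrite -ler_expR lnK ?posrE// ltW.
apply: (@le_trans _ _
    (\esum_(k in [set k : int | (k <= m)%R]) (expR (k%:~R * r))%:E)).
  by apply: le_esum_set => // k _; rewrite lee_fin expR_ge0.
rewrite (reindex_esum [set: nat] _ (fun j : nat => m - j%:Z)%R); last first.
  split=> //=.
  - by move=> j _ /=; lia.
  - by move=> i j _ _ /=; lia.
  - by move=> k /= km; exists `|m - k|%N => //; lia.
rewrite -nneseries_esumT; last by move=> n; rewrite lee_fin expR_ge0.
apply: lime_le.
  by apply: is_cvg_nneseries => n _ _; rewrite lee_fin expR_ge0.
apply: nearW => n; rewrite sumEFin lee_fin.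
have -> : (\sum_(0 <= j < n) expR ((m - j%:Z)%:~R * r) =
    \sum_(0 <= j < n) expR (m%:~R * r) * expR (- r) ^+ j)%R.
  apply: eq_bigr => j _; rewrite -expRM_natl -expRD; congr expR.
  by rewrite intrB /=; ring.
rewrite -mulr_sumr mulrC; apply: ler_pM.
- by apply: sumr_ge0 => i _; rewrite exprn_ge0 ?ltW.
- exact: expR_ge0.
- rewrite -[leRHS]mul1r ler_pdivlMr ?subr_gt0// big_mkord mulrC.
  have := subrX1 (expR (- r)) n; have := exprn_ge0 n (ltW z0); lra.
- rewrite expRM; apply: ge0_ler_powR; rewrite ?nnegrE ?expR_ge0 ?(ltW r0) ?(ltW s0)//.
  by rewrite -[leRHS]lnK ?posrE// ler_expR floor_le.
Qed.


(** Levels grow geometrically, so the single term of the last level [k] below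
    [u / 2] already accounts for [u `^ q]. *)
Lemma layer_cake_lower (q : R) (u : \bar R) : (0 < q)%R -> 0 <= u ->
  u `^ q <= ((2 * expR 1) `^ q)%:E *
    \esum_(k in [set k : int | (2 * expR k%:~R)%:E < u]) (expR (k%:~R * q))%:E.
Proof.
move=> q0; have c0 : (0 < (2 * expR 1) `^ q :> R)%R.
  by rewrite powR_gt0 ?mulr_gt0 ?expR_gt0.
have e0 (k : int) : 0 <= (expR (k%:~R * q))%:E by rewrite lee_fin expR_ge0.
case: u => [u| |] //; last first.
  move=> _; rewrite (_ : \esum_(_ in _) _ = +oo) ?gt0_muley ?leey ?lte_fin//.
  apply/eq_infty => t.
  pose k : int := (Num.trunc (`|t| / q)).+1.
  apply: le_trans (@ge_esum_point _ _ _ _ k _ e0) => //=; last by rewrite ltry.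
  rewrite lee_fin; apply: le_trans (expR_ge1Dx _).
  apply: le_trans (ler_norm t) _; rewrite ler_wpDl//.
  by rewrite -ler_pdivrMr// ltW// truncnS_gt.
rewrite lee_fin le_eqVlt => /predU1P[<-|u0].
  by rewrite poweR_EFin powR0 ?gt_eqF// mule_ge0// ?lee_fin ?(ltW c0)// esum_ge0.
pose k : int := (Num.ceil (ln (u / 2)) - 1)%R.
have u20 : (0 < u / 2)%R by rewrite divr_gt0.
have ku : (expR k%:~R < u / 2)%R.
  by rewrite -[ltRHS]lnK ?posrE// ltr_expR; exact: ceilB1_lt.
have uk : (u / 2 <= expR (k%:~R + 1))%R.
  rewrite -[leLHS]lnK ?posrE// ler_expR.
  by have := ceil_ge (ln (u / 2)); rewrite intrB; lra.
apply: le_trans (lee_wpmul2l _ (@ge_esum_point _ _ _ _ k _ e0)); last 2 first.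
- by rewrite lee_fin ltW.
- by rewrite /= lte_fin mulrC -ltr_pdivlMr.
rewrite poweR_EFin -EFinM lee_fin expRM -powRM ?mulr_ge0 ?expR_ge0//.
apply: ge0_ler_powR; rewrite ?nnegrE ?(ltW q0) ?(ltW u0) ?mulr_ge0 ?expR_ge0//.
by rewrite -mulrA mulrC -ler_pdivrMr// -expRD addrC.
Qed.

(** What interpolation yields at a point of mass [n] where the function has the
    value [g]: a geometric sum over the levels below [g], times [g] once more;
    [g] may be infinite. *)
Lemma layer_cake_upper (r n : R) (g : \bar R) : (0 < r)%R -> (0 < n)%R -> 0 <= g ->
  \esum_(k in [set k : int | (expR k%:~R)%:E < g])
    ((expR (k%:~R * r))%:E * (g * n%:E)) <=
  ((1 - expR (- r))^-1)%:E * (g `^ (r + 1) * n%:E).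
Proof.
move=> r0 n0.
have c0 : (0 < (1 - expR (- r))^-1)%R.
  by rewrite invr_gt0 subr_gt0 -expR0 ltr_expR oppr_lt0.
case: g => [g| |] //; last first.
  move=> _; rewrite poweRyr ?gt0_mulye ?gt0_muley ?leey ?lte_fin//.
  by rewrite gt_eqF// addr_gt0.
rewrite lee_fin le_eqVlt => /predU1P[<-|g0].
  rewrite esum1 => [|k _]; last by rewrite mul0e mule0.
  by rewrite !mule_ge0 ?poweR_ge0 ?lee_fin ?(ltW c0) ?(ltW n0).
rewrite -EFinM; under eq_esum do rewrite muleC.
rewrite esumZl ?mulr_ge0 ?(ltW g0) ?(ltW n0)//.
have gn0 : 0 <= (g * n)%:E by rewrite lee_fin mulr_ge0 ?(ltW g0) ?(ltW n0).
apply: le_trans (lee_wpmul2l gn0 (layer_cake_geometric r0 g0)) _.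
rewrite poweR_EFin -!EFinM lee_fin powRD ?(gt_eqF g0) ?implybT// powRr1 ?(ltW g0)//.
by rewrite le_eqVlt; apply/orP; left; apply/eqP; ring.
Qed.

End LayerCake.

Section StrongType.
Context (R : realType) (T : choiceType) (nu : T -> R) (K q : R).
Local Open Scope ereal_scope.

(** A discrete form of Marcinkiewicz interpolation: decompose [m `^ q] into the
    levels [expR k], apply the weak bound at each level, exchange the two sums,
    and sum over the levels below [g y] at each point [y]. *)
Lemma interpolation (g m : T -> \bar R) : (1 < q)%R -> (0 <= K)%R ->
  (forall x, 0 < nu x)%R -> (forall x, 0 <= g x) -> (forall x, 0 <= m x) ->
  (forall t : R, (0 <= t)%R ->
    t%:E * (\esum_(x in [set x | (2 * t)%:E < m x]) (nu x)%:E) <=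
    K%:E * \esum_(y in [set y | t%:E < g y]) (g y * (nu y)%:E)) ->
  \esum_(x in setT) (m x `^ q * (nu x)%:E) <=
  ((2 * expR 1) `^ q * K * (1 - expR (- (q - 1)))^-1)%:E *
    \esum_(x in setT) (g x `^ q * (nu x)%:E).
Proof.
move=> q1 K0 nu0 g0 m0 weak.
have q0 : (0 < q)%R by lra.
have nu0' x : 0 <= (nu x)%:E by rewrite lee_fin ltW.
have e0 (a : R) : 0 <= (expR a)%:E by rewrite lee_fin expR_ge0.
set c1 := ((2 * expR 1) `^ q)%R; have c10 : (0 <= c1)%R by exact: powR_ge0.
set c2 := ((1 - expR (- (q - 1)))^-1)%R.
have c20 : (0 <= c2)%R.
  by rewrite invr_ge0 subr_ge0 -[leRHS]expR0 ler_expR; lra.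
pose P k := [set x | (2 * expR k%:~R)%:E < m x].
pose Q k := [set x | (expR k%:~R)%:E < g x].
pose a (k : int) := (expR (k%:~R * q))%:E.
apply: (@le_trans _ _ (\esum_(x in setT) (c1%:E *
    \esum_(k in setT) (if x \in P k then a k * (nu x)%:E else 0)))).
  apply: le_esum => x _.
  apply: le_trans (lee_wpmul2r (nu0' x) (layer_cake_lower q0 (m0 x))) _.
  rewrite -muleA; apply: lee_wpmul2l; first by rewrite lee_fin.
  rewrite muleC -esumZl ?(ltW (nu0 x))//.
  rewrite esum_mkcond; apply: le_esum => k _.
  rewrite (_ : (k \in _) = (x \in P k)); last by apply/idP/idP; rewrite !inE.
  by case: ifP => // _; rewrite muleC.
have a0 k : 0 <= a k by exact: e0.
have f0 x k : 0 <= (if x \in P k then a k * (nu x)%:E else 0).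
  by case: ifP => _; rewrite ?mule_ge0.
rewrite esumZl//; last by move=> x _; exact: esum_ge0.
rewrite esum_exchange//.
rewrite -!mulrA (EFinM c1) -muleA; apply: lee_wpmul2l; first by rewrite lee_fin.
apply: (@le_trans _ _ (\esum_(k in [set: int]) (K%:E *
   \esum_(y in setT) if y \in Q k then
     (expR (k%:~R * (q - 1)))%:E * (g y * (nu y)%:E) else 0))).
  apply: le_esum => k _; rewrite -!esum_mkcond !esumZl ?expR_ge0//; last first.
    by move=> y _; rewrite mule_ge0.
  rewrite muleCA (_ : (expR (k%:~R * q))%:E =
    (expR (k%:~R * (q - 1)))%:E * (expR k%:~R)%:E).
    rewrite -muleA; apply: lee_wpmul2l => //; apply: weak; exact: expR_ge0.
  by rewrite -EFinM -expRD; congr (expR _)%:E; ring.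
have h0 y k : 0 <= (if y \in Q k then
     (expR (k%:~R * (q - 1)))%:E * (g y * (nu y)%:E) else 0).
  by case: ifP => _; rewrite ?mule_ge0.
rewrite esumZl//; last by move=> k _; exact: esum_ge0.
rewrite EFinM -muleA; apply: lee_wpmul2l; first by rewrite lee_fin.
rewrite esum_exchange// -esumZl//; last by move=> y _; rewrite mule_ge0 ?poweR_ge0.
apply: le_esum => y _.
have := @layer_cake_upper _ (q - 1)%R (nu y) (g y).
rewrite subr_gt0 subrK => /(_ q1 (nu0 y) (g0 y)); apply: le_trans.
rewrite [leRHS]esum_mkcond; apply: le_esum => k _.
by rewrite (_ : (y \in Q k) = (k \in [set k : int | (expR k%:~R)%:E < g y]));
  last by apply/idP/idP; rewrite !inE.
Qed.

End StrongType.

(** * Measure and covering properties of trapezoids *)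

Section Trapezoids.
Context (T : tree) (omega : set (nat -> T)) (homega : boundary T omega).
Context (R : realType) (o : T) (mu : T -> R) (hmu : flow_measure omega o mu).
Context (beta : R).
Implicit Types (x y z : T).

Local Notation up := (parent omega).
Local Notation trap := (trapezoid omega).
Local Notation lev := (level R omega o).

Lemma mu_gt0 x : 0 < mu x. Proof. by case: hmu. Qed.

(** The flow property, iterated: each generation of descendants of [x] carries
    the mass of [x]. *)
Lemma mass_layer k x :
  (\esum_(y in [set y | iter k up y = x]) (mu y)%:E)%E = (mu x)%:E.
Proof.
have mu0 y : (0 <= (mu y)%:E)%E by rewrite lee_fin ltW// mu_gt0.
elim: k x => [|k IH] x; first by rewrite esum_set1.
rewrite (@esum_fibers _ _ _ [set z | iter k up z = x] _ up)//; last first.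
  by move=> y /=; rewrite -iterSr.
rewrite -IH; apply: eq_esum => z zx; have [_ ->] := hmu.
rewrite successorsE//; congr esum; apply/seteqP; split=> y; first by case.
by move=> /= yz; split=> //=; rewrite -iterS iterSr yz.
Qed.

Lemma trap_cat x a b c : (a <= b)%N -> (b <= c)%N ->
  trap x a c = trap x a b `|` trap x b c.
Proof.
move=> ab bc; rewrite !trapezoidE//; apply/seteqP; split=> y /=.
  by move=> [k hk ky]; have [kb|kb] := ltnP k b; [left|right]; exists k => //; lia.
by move=> [] [k hk ky]; exists k => //; lia.
Qed.

Lemma trap_sub x a b c d : (c <= a)%N -> (b <= d)%N -> trap x a b `<=` trap x c d.
Proof.
by move=> ca bd; rewrite !trapezoidE// => y [k hk ky]; exists k => //; lia.
Qed.

Lemma trap_layer x h : trap x h h.+1 = [set y | iter h up y = x].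
Proof.
rewrite trapezoidE//; apply/seteqP; split=> y /=.
  by move=> [k hk <-]; congr iter; lia.
by move=> hy; exists h => //; lia.
Qed.

Lemma mass_trap x h n :
  mass mu (trap x h (h + n)%N) = (n%:R * mu x)%:E.
Proof.
have mu0 y : (0 <= (mu y)%:E)%E by rewrite lee_fin ltW// mu_gt0.
rewrite /mass; elim: n => [|n IH].
  rewrite addn0 mul0r (_ : trap _ _ _ = set0) ?esum_set0//.
  by rewrite trapezoidE//; apply/seteqP; split=> y //= [k]; lia.
rewrite (@trap_cat x h (h + n)%N) ?leq_addr ?leq_add2l// addnS trap_layer.
rewrite esumU//; last first.
  rewrite trapezoidE//; apply/seteqP; split=> y //= [[k hk ky] hny].
  by move: hk; rewrite (iter_parent_inj homega (etrans ky (esym hny))); lia.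
by rewrite IH mass_layer -EFinD -natr1 mulrDl mul1r.
Qed.

(** Sets of the family are handled through their root and heights: one set can
    have several such descriptions, and covering compares the roots. Singletons
    are described by the heights 0 and 1. *)
Definition trap_index := (T * nat * nat)%type.
Definition apex (i : trap_index) : T := i.1.1.
Definition trap_of (i : trap_index) : set T := trap i.1.1 i.1.2 i.2.
Definition valid : set trap_index :=
  [set i | admissible beta i.1.2 i.2 \/ (i.1.2 = 0%N /\ i.2 = 1%N)].

Lemma trap01 x : trap x 0 1 = [set x].
Proof. by rewrite trap_layer. Qed.

Lemma trapezoidsP E :
  trapezoids omega beta E <-> exists2 i, valid i & E = trap_of i.
Proof.
split.
  move=> [[x [h1 [h2 [adm ->]]]]|[x ->]]; first by exists (x, h1, h2) => //; left.
  by exists (x, 0%N, 1%N); [right|rewrite /trap_of trap01].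
move=> [[[x h1] h2] /= [adm|[/= -> ->]] ->]; last by right; exists x; exact: trap01.
by left; exists x, h1, h2.
Qed.

Lemma valid_lt i : valid i -> (i.1.2 < i.2)%N.
Proof. by move=> [[]|[-> ->]]. Qed.

Lemma mass_trap_of i : valid i ->
  mass mu (trap_of i) = ((i.2 - i.1.2)%:R * mu (apex i))%:E.
Proof.
by move=> /valid_lt hi; rewrite /trap_of -{1}(subnKC (ltnW hi)) mass_trap.
Qed.

Lemma mass_valid_gt0 i : valid i -> (0 < mass mu (trap_of i))%E.
Proof.
move=> vi; rewrite mass_trap_of// lte_fin mulr_gt0 ?mu_gt0// ltr0n subn_gt0.
exact: valid_lt.
Qed.

Lemma mass_valid_fin i : valid i -> (mass mu (trap_of i) < +oo)%E.
Proof. by move=> vi; rewrite mass_trap_of// ltry. Qed.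

Lemma trap_of_neq0 i : valid i -> trap_of i !=set0.
Proof.
move=> vi; apply/set0P/eqP => e; have := mass_valid_gt0 vi.
by rewrite e /mass esum_set0 ltxx.
Qed.

Section Covering.
Context (N : nat) (hN : beta <= (2 ^ N)%:R).

(** The heights that are comparable, up to the factor [2 ^ N], to some height
    of the trapezoid; unlike a range with explicit bounds, this treats
    singletons and admissible trapezoids alike. *)
Definition dilate (i : trap_index) : set T :=
  [set y | exists k j, [/\ iter k up y = apex i, (i.1.2 <= j < i.2)%N,
    (k <= 2 ^ N * j)%N & (j <= 2 ^ N * k)%N]].

Lemma admissible_le h1 h2 : admissible beta h1 h2 -> (h2 <= 2 ^ N * h1)%N.
Proof.
move=> [h0 _ /andP[_ hb]]; rewrite -(ler_nat R) natrM -ler_pdivrMr ?ltr0n//.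
exact: le_trans hN.
Qed.

Lemma comparable_heights i a b : valid i ->
  (i.1.2 <= a < i.2)%N -> (i.1.2 <= b < i.2)%N -> (a <= 2 ^ N * b)%N.
Proof.
move=> [/admissible_le hi|[-> ->]] /andP[ha ha'] /andP[hb hb']; last by lia.
have : (2 ^ N * i.1.2 <= 2 ^ N * b)%N by rewrite leq_mul2l hb orbT.
by lia.
Qed.

(** If two trapezoids meet then the lower of the two roots is below the other
    one, and distances to it differ from distances to the higher one by the
    same quantity; heights that are comparable stay so after adding it. *)
Lemma trap_covering i j : valid i -> valid j -> lev (apex j) <= lev (apex i) ->
  trap_of i `&` trap_of j !=set0 -> trap_of j `<=` dilate i.
Proof.
move=> vi vj ji [z []]; rewrite /trap_of !trapezoidE//.
move=> [a ha az] [b hb bz] y [c hc cy].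
have ba : (b <= a)%N.
  move: ji; rewrite /apex -az -bz !level_iter_parent//.
  by rewrite lerD2l ler_nat.
exists (a - b + c)%N, a; split=> //.
- by rewrite iterD cy -bz -iterD subnK.
- have := comparable_heights vj hc hb.
  have := leq_pmull (a - b) (expn_gt0 2 N); nia.
- have := comparable_heights vj hb hc.
  have := leq_pmull (a - b) (expn_gt0 2 N); nia.
Qed.

Hypothesis hbeta : 4 <= beta.
Context (nu : T -> R) (nu_gt0 : forall x, 0 < nu x) (D : R) (D0 : 0 <= D).
Hypothesis doubling : forall Q E, trapezoids omega beta Q -> E `<=` Q ->
  (mass mu Q <= 3%:E * mass mu E)%E -> (mass nu Q <= D%:E * mass nu E)%E.

Let nu_ge0 x : (0 <= (nu x)%:E)%E. Proof. by rewrite lee_fin ltW. Qed.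

Let le_mass (E F : set T) : E `<=` F -> (mass nu E <= mass nu F)%E.
Proof. by move=> EF; exact: le_esum_set. Qed.

Let W x a b := mass nu (trap x (2 ^ a)%N (2 ^ b)%N).

(** Ratio 4 makes the dyadic windows admissible, and leaves room for two
    consecutive smaller windows, each with a third of the mass or more, between
    which the doubling hypothesis can be applied. *)
Lemma window_trapezoid x a :
  trapezoids omega beta (trap x (2 ^ a)%N (2 ^ a.+2)%N).
Proof.
left; exists x, (2 ^ a)%N, (2 ^ a.+2)%N; split=> //; split.
- by rewrite expn_gt0.
- by rewrite ltn_exp2l.
- have -> : (2 ^ a.+2)%:R / (2 ^ a)%:R = 4 :> R.
    by rewrite !expnS mulnA natrM mulfK// pnatr_eq0 expn_eq0.
  by rewrite hbeta andbT; lra.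
Qed.

Lemma window_doubling x a b c : (2 ^ a <= b)%N -> (b + 2 ^ a <= c)%N ->
  (c <= 2 ^ a.+2)%N ->
  (W x a a.+2 <= D%:E * mass nu (trap x b c))%E.
Proof.
move=> ab bc ca; apply: doubling; first exact: window_trapezoid.
  exact: trap_sub.
have -> : (2 ^ a.+2 = 2 ^ a + 3 * 2 ^ a)%N by rewrite !expnS; lia.
rewrite mass_trap -(@subnKC b c) ?mass_trap; last by lia.
rewrite -EFinM lee_fin natrM -mulrA ler_pM2l// ler_pM2r ?mu_gt0//.
by rewrite ler_nat; lia.
Qed.

Lemma window_up x a b : (a < b)%N -> (W x a b.+1 <= (1 + D)%:E * W x a b)%E.
Proof.
case: b => // b ab.
rewrite /W (@trap_cat x _ (2 ^ b.+1)%N); [|by rewrite leq_exp2l// ltnW..].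
apply: le_trans (le_esumU _ _ nu_ge0) _.
rewrite EFinD ge0_muleDl// mul1e leeD//.
have le1 : (mass nu (trap x (2 ^ b.+1)%N (2 ^ b.+2)%N) <= W x b b.+2)%E.
  by apply/le_mass/trap_sub => //; rewrite leq_exp2l.
apply: le_trans le1 _.
apply: le_trans (@window_doubling x b (2 ^ b)%N (2 ^ b.+1)%N _ _ _) _.
- by [].
- by rewrite expnS; lia.
- by rewrite leq_exp2l.
- apply: lee_wpmul2l; rewrite ?lee_fin//; apply/le_mass/trap_sub => //.
  by rewrite leq_exp2l.
Qed.

Lemma window_down x a b : (a.+1 < b)%N ->
  (W x a b <= (1 + D)%:E * W x a.+1 b)%E.
Proof.
move=> ab.
rewrite /W (@trap_cat x _ (2 ^ a.+1)%N); [|by rewrite leq_exp2l// ltnW..].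
apply: le_trans (le_esumU _ _ nu_ge0) _.
rewrite EFinD ge0_muleDl// mul1e addeC leeD//.
have le1 : (mass nu (trap x (2 ^ a)%N (2 ^ a.+1)%N) <= W x a a.+2)%E.
  by apply/le_mass/trap_sub => //; rewrite leq_exp2l.
apply: le_trans le1 _.
apply: le_trans (@window_doubling x a (2 ^ a.+1)%N (2 ^ a.+2)%N _ _ _) _.
- by rewrite leq_exp2l.
- by rewrite !expnS; lia.
- by [].
- apply: lee_wpmul2l; rewrite ?lee_fin//; apply/le_mass/trap_sub => //.
  by rewrite leq_exp2l.
Qed.

Let C0 : 0 <= 1 + D. Proof. by rewrite addr_ge0. Qed.

Lemma window_up_iter x a b n : (a < b)%N ->
  (W x a (b + n)%N <= ((1 + D) ^+ n)%:E * W x a b)%E.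
Proof.
move=> ab; elim: n => [|n IH]; first by rewrite addn0 expr0 mul1e.
rewrite addnS exprS EFinM -muleA.
apply: le_trans (window_up x _) _; first by lia.
by apply: lee_wpmul2l; rewrite ?lee_fin.
Qed.

Lemma window_down_iter x a b n : (a < b)%N ->
  (W x (a - n)%N b <= ((1 + D) ^+ n)%:E * W x a b)%E.
Proof.
move=> ab; elim: n => [|n IH]; first by rewrite subn0 expr0 mul1e.
rewrite subnS exprS EFinM -muleA.
have [an|an] := posnP (a - n)%N.
  rewrite an /= -an; apply: le_trans IH _.
  rewrite -[leLHS]mul1e; apply: lee_wpmul2r.
    by rewrite mule_ge0 ?esum_ge0// lee_fin exprn_ge0.
  by rewrite lee_fin lerDl.
apply: le_trans (window_down x (a := (a - n).-1) _) _; first by lia.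
by rewrite prednK//; apply: lee_wpmul2l; rewrite ?lee_fin.
Qed.

(** The dilate is inside a dyadic window around that of [h1], from which it can
    be reached in [N] steps downwards and [2 * N] steps upwards. *)
Lemma mass_dilate i : valid i ->
  (mass nu (dilate i) <= ((1 + D) ^+ (3 * N).+1)%:E * mass nu (trap_of i))%E.
Proof.
have K1 n : 1 <= (1 + D) ^+ n by rewrite exprn_ege1// lerDl.
case: i => [[x h1] h2] vi; have [/= adm|/= [h10 h21]] := vi; last first.
  apply: (@le_trans _ _ (mass nu (trap_of (x, h1, h2)))).
    apply: le_mass => y [k [j /= [ky hj hk _]]].
    have k0 : k = 0%N by move: hj hk; rewrite h10 h21; case: j => //; lia.
    by rewrite /trap_of trapezoidE//; exists k => //=; rewrite h10 h21 k0.
  by rewrite -[leLHS]mul1e; apply: lee_wpmul2r; rewrite ?esum_ge0// lee_fin.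
have [h10 h12 /andP[ratio _]] := adm.
have h122 : (2 * h1 <= h2)%N.
  by rewrite -(ler_nat R) natrM -ler_pdivlMr// ltr0n.
have h2N := admissible_le adm.
pose k0 := trunc_log 2 h1.
have [k01 k02] : (2 ^ k0 <= h1)%N /\ (h1 < 2 ^ k0.+1)%N.
  by have /andP[] := @trunc_log_bounds 2 h1 isT h10.
have sub : dilate (x, h1, h2) `<=` trap x (2 ^ (k0 - N))%N (2 ^ (k0.+1 + 2 * N))%N.
  move=> y [k [j /= [ky /andP[hj hj'] hk hjk]]].
  rewrite trapezoidE//; exists k => //; apply/andP; split.
    have [kN|kN] := leqP N k0.
      rewrite -(@leq_pmul2l (2 ^ N)) ?expn_gt0// -expnD subnKC//.
      by apply: leq_trans k01 (leq_trans hj hjk).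
    have -> : (k0 - N = 0)%N by lia.
    by rewrite expn0 lt0n; apply: contraTneq h10 => k00; move: hjk; rewrite k00; lia.
  apply: leq_ltn_trans hk _.
  rewrite mul2n -addnn addnC -addnA expnD ltn_pmul2l ?expn_gt0//.
  apply: leq_trans hj' (leq_trans h2N _).
  by rewrite expnD leq_mul2l ltnW ?orbT.
apply: le_trans (le_mass sub) _.
apply: le_trans (window_down_iter x N _) _; first by lia.
have -> : ((1 + D) ^+ (3 * N).+1 = (1 + D) ^+ N * ((1 + D) ^+ (2 * N) * (1 + D)))%R.
  by rewrite -exprSr -exprD; congr (_ ^+ _); lia.
rewrite !EFinM -!muleA; apply: lee_wpmul2l; first by rewrite lee_fin exprn_ge0.
apply: le_trans (window_up_iter x (2 * N) (ltnSn k0)) _.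
apply: lee_wpmul2l; first by rewrite lee_fin exprn_ge0.
apply: (@le_trans _ _ (W x k0 k0.+2)).
  by apply/le_mass/trap_sub => //; rewrite leq_exp2l.
apply: le_trans (@window_doubling x k0 h1 (2 * h1)%N _ _ _) _ => //.
- by lia.
- by rewrite expnS leq_mul2l/= ltnW.
- apply: lee_pmul; rewrite ?esum_ge0 ?lee_fin ?lerDr//.
  exact/le_mass/trap_sub.
Qed.

End Covering.
End Trapezoids.

(** * Muckenhoupt weights *)

Section Muckenhoupt.
Context (R : realType) (T : choiceType) (mu : T -> R) (F : set (set T)).
Hypothesis mu_pos : forall x, 0 < mu x.

Local Notation msr w E := (\esum_(y in E) (w y * mu y)%:E)%E.
Local Notation vol E := (\esum_(y in E) (mu y)%:E)%E.

Hypothesis F_gt0 : forall Q, F Q -> (0 < vol Q)%E.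

(** This is the condition A_p with [r = p - 1] and [s] the dual weight of [w],
    freed of its quotients: it is then symmetric in [w] and [s], up to changing
    [r] into its inverse, and what holds for [w] holds for [s]. *)
Definition muckenhoupt (r K : R) (w s : T -> R) :=
  forall Q, F Q -> exists W S m : R,
    [/\ msr w Q = W%:E, msr s Q = S%:E, vol Q = m%:E &
        W * S `^ r <= K * m `^ (r + 1)].

Lemma msr_gt0 (w : T -> R) Q : (forall x, 0 < w x) -> Q !=set0 ->
  (0 < msr w Q)%E.
Proof.
move=> w0 [x Qx]; apply: lt_le_trans (ge_esum_point Qx _) => [|y].
  by rewrite lte_fin mulr_gt0.
by rewrite lee_fin mulr_ge0 ?ltW.
Qed.

Lemma vol_neq0 E : (0 < vol E)%E -> E !=set0.
Proof.
by apply: contraPP => /set0P/negP/negPn/eqP->; rewrite esum_set0 ltxx.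
Qed.

Lemma muckenhoupt_dual r K w s : 0 < r -> 0 <= K -> (forall x, 0 < w x) ->
  (forall x, 0 < s x) ->
  muckenhoupt r K w s -> muckenhoupt r^-1 (K `^ r^-1) s w.
Proof.
move=> r0 K0 w0 s0 wF Q FQ; have [W [S [m [WE SE mE H]]]] := wF Q FQ.
exists S, W, m; split=> //.
have Q0 := vol_neq0 (F_gt0 FQ).
have W0 : 0 < W by rewrite -lte_fin -WE msr_gt0.
have S0 : 0 < S by rewrite -lte_fin -SE msr_gt0.
have m0 : 0 < m by rewrite -lte_fin -mE F_gt0.
have rV0 : 0 <= r^-1 by rewrite invr_ge0 ltW.
have := ge0_ler_powR rV0 _ _ H.
rewrite !nnegrE !mulr_ge0 ?powR_ge0 ?(ltW W0)// => /(_ isT isT).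
rewrite !powRM ?powR_ge0 ?(ltW W0)// -!powRrM divff ?gt_eqF//.
by rewrite powRr1 ?(ltW S0)// mulrC mulrDl divff ?gt_eqF// mul1r (addrC 1).
Qed.

(** Hoelder's inequality up to the constant, by an elementary argument: since
    [s = w `^ (- 1 / r)], for each [c > 0] one has [w >= c] or
    [s >= c `^ (- 1 / r)] at each point; the choice of [c] makes the first
    alternative account for half of the mass of [E]. *)
Lemma quasi_hoelder (r W S m : R) (w s : T -> R) E :
  0 < r -> (forall x, 0 < w x) -> (forall x, s x = w x `^ (- r^-1)) ->
  msr w E = W%:E -> msr s E = S%:E -> vol E = m%:E -> 0 < m ->
  m `^ (r + 1) <= 2 `^ (r + 1) * (W * S `^ r).
Proof.
move=> r0 w0 sE WE SE mE m0.
have s0 x : 0 < s x by rewrite sE powR_gt0.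
have E0 : E !=set0 by apply: vol_neq0; rewrite mE lte_fin.
have W0 : 0 < W by rewrite -lte_fin -WE msr_gt0.
have S0 : 0 < S by rewrite -lte_fin -SE msr_gt0.
have [c cE] : exists c, c = 2 * W / m by exists (2 * W / m).
have c0 : 0 < c by rewrite cE !mulr_gt0// invr_gt0.
have split x : mu x <= c^-1 * (w x * mu x) + c `^ r^-1 * (s x * mu x).
  rewrite !mulrA -mulrDl ler_peMl ?(ltW (mu_pos x))//.
  have [cw|wc] := leP c (w x).
    apply: ler_wpDr; first by rewrite mulr_ge0 ?powR_ge0 ?ltW.
    by rewrite mulrC ler_pdivlMr// mul1r.
  apply: ler_wpDl; first by rewrite mulr_ge0 ?invr_ge0 ?ltW.
  rewrite sE powRN ler_pdivlMr ?powR_gt0// mul1r.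
  by apply: ge0_ler_powR; rewrite ?invr_ge0 ?nnegrE ?ltW.
have half : m / 2 <= c `^ r^-1 * S.
  have : (vol E <= \esum_(x in E) ((c^-1)%:E * (w x * mu x)%:E) +
      \esum_(x in E) ((c `^ r^-1)%:E * (s x * mu x)%:E))%E.
    rewrite -esumD; [|by move=> x _; rewrite -EFinM lee_fin !mulr_ge0 ?powR_ge0
      ?invr_ge0 ?ltW..].
    by apply: le_esum => x _; rewrite lee_fin.
  rewrite !esumZl ?powR_ge0 ?invr_ge0 ?(ltW c0)//; [|by move=> x _;
    rewrite lee_fin mulr_ge0 ?ltW..].
  rewrite WE SE mE -!EFinM -EFinD lee_fin.
  have -> : c^-1 * W = m / 2.
    by rewrite cE; field; rewrite (gt_eqF W0) (gt_eqF m0).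
  lra.
have := ge0_ler_powR (ltW r0) _ _ half.
rewrite !nnegrE !mulr_ge0 ?powR_ge0 ?invr_ge0 ?(ltW S0) ?(ltW m0)//.
move=> /(_ isT isT).
rewrite !powRM ?powR_ge0 ?invr_ge0 ?(ltW S0) ?(ltW m0)// -powRrM mulVf ?gt_eqF//.
rewrite powRr1 ?(ltW c0)// -powR_inv1// -powRrM mulN1r powRN.
rewrite ler_pdivrMr ?powR_gt0// => mS.
rewrite !powRD ?(gt_eqF m0) ?implybT ?pnatr_eq0 ?implybT//.
rewrite !powRr1 ?(ltW m0)//.
apply: le_trans (ler_wpM2r (ltW m0) mS) _.
by rewrite le_eqVlt; apply/orP; left; apply/eqP; rewrite cE; field; rewrite gt_eqF.
Qed.

(** Compare the condition on [Q], which bounds [w] of [Q] times a power of [s]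
    of [Q], with the reverse inequality on [E], where [s] of [E] is at most [s]
    of [Q]. The constant 6 is 3, from the masses, times 2, from
    [quasi_hoelder]. *)
Lemma muckenhoupt_doubling r K w s (Q E : set T) : 0 < r -> 0 <= K ->
  (forall x, 0 < w x) -> (forall x, s x = w x `^ (- r^-1)) ->
  muckenhoupt r K w s -> F Q -> E `<=` Q -> (vol Q <= 3%:E * vol E)%E ->
  (msr w Q <= (K * 6 `^ (r + 1))%:E * msr w E)%E.
Proof.
move=> r0 K0 w0 sE wF FQ EQ volQE.
have s0 x : 0 < s x by rewrite sE powR_gt0.
have [W [S [m [WE SE mE H]]]] := wF Q FQ.
have m0 : 0 < m by rewrite -lte_fin -mE F_gt0.
have fin (v : T -> R) (V : R) : (forall x, 0 < v x) ->
    (\esum_(y in Q) (v y)%:E = V%:E)%E ->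
    exists V', (\esum_(y in E) (v y)%:E = V'%:E)%E /\ V' <= V.
  move=> v0 VE; have vE : (\esum_(y in E) (v y)%:E <= V%:E)%E.
    by rewrite -VE; apply: le_esum_set => // y _; rewrite lee_fin ltW.
  have vf : (\esum_(y in E) (v y)%:E \is a fin_num)%E.
    rewrite ge0_fin_numE; last by apply: esum_ge0 => y _; rewrite lee_fin ltW.
    exact: le_lt_trans vE (ltry _).
  by exists (fine (\esum_(y in E) (v y)%:E)); rewrite -lee_fin !fineK.
have [m' [mE' _]] := fin mu m mu_pos mE.
have [|W' [WE' _]] := fin (fun y => w y * mu y) W _ WE.
  by move=> x; rewrite mulr_gt0.
have [|S' [SE' SS']] := fin (fun y => s y * mu y) S _ SE.
  by move=> x; rewrite mulr_gt0.
move: volQE; rewrite mE mE' -EFinM lee_fin => mm'.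
have m'0 : 0 < m' by lra.
have S'0 : 0 < S'.
  rewrite -lte_fin -SE' msr_gt0//; apply: vol_neq0.
  by rewrite mE' lte_fin.
have W'0 : 0 <= W'.
  by rewrite -lee_fin -WE' esum_ge0// => x _; rewrite lee_fin mulr_ge0// ltW.
have r10 : 0 <= r + 1 by rewrite addr_ge0 ?ltW.
have qh := quasi_hoelder r0 w0 sE WE' SE' mE' m'0.
have mp : m `^ (r + 1) <= 3 `^ (r + 1) * m' `^ (r + 1).
  rewrite -powRM ?(ltW m'0)//; apply: ge0_ler_powR; rewrite ?nnegrE ?(ltW m0)//.
  by rewrite mulr_ge0 ?(ltW m'0).
have Sr : S' `^ r <= S `^ r.
  apply: ge0_ler_powR; rewrite ?nnegrE ?(ltW r0) ?(ltW S'0)//.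
  exact: le_trans (ltW S'0) SS'.
rewrite WE WE' -EFinM lee_fin -(@ler_pM2r _ (S `^ r)); last first.
  by apply: powR_gt0; exact: lt_le_trans SS'.
apply: le_trans H _; rewrite -!mulrA; apply: ler_wpM2l => //.
apply: le_trans mp _.
have -> : 6 `^ (r + 1) = 3 `^ (r + 1) * 2 `^ (r + 1) :> R.
  by rewrite -powRM//; congr (_ `^ _); lra.
rewrite -mulrA; apply: ler_wpM2l; first exact: powR_ge0.
apply: le_trans qh _; apply: ler_wpM2l; first exact: powR_ge0.
exact: ler_wpM2l.
Qed.
End Muckenhoupt.

(** * Lerner's pointwise domination *)

Section PointwiseDomination.
Context (R : realType) (T : choiceType) (I : eqType) (ok : set I) (A : I -> set T).
Context (mu w s : T -> R) (r K : R).
Hypothesis mu_gt0 : forall x, 0 < mu x.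
Hypothesis w_gt0 : forall x, 0 < w x.
Hypothesis s_gt0 : forall x, 0 < s x.
Hypothesis r_gt0 : 0 < r.
Hypothesis K_ge0 : 0 <= K.
Hypothesis A_neq0 : forall i, ok i -> A i !=set0.
Hypothesis ws : muckenhoupt mu [set A i | i in ok] r K w s.
Local Open Scope ereal_scope.

Lemma ge0_le_esumZl (E : set T) (a : T -> \bar R) (c : \bar R) :
  0 <= c -> (forall x, 0 <= a x) ->
  c * (\esum_(x in E) a x) <= \esum_(x in E) (c * a x).
Proof.
case: c => [c| |]// c0 a0; first by rewrite esumZl.
have [[x [Ex ax]]|a00] := pselect (exists x, E x /\ 0 < a x).
  rewrite (_ : \esum_(x in E) (+oo * a x) = +oo) ?leey//.
  apply/eqP; rewrite -leye_eq.
  apply: le_trans (ge_esum_point Ex _); first by rewrite gt0_mulye.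
  by move=> y; rewrite mule_ge0.
rewrite esum1 ?mule0 ?esum_ge0// => x Ex; first by rewrite mule_ge0.
apply/eqP; rewrite eq_le a0 andbT leNgt; apply/negP => ax.
by apply: a00; exists x.
Qed.

Definition dual_max (g : T -> \bar R) : T -> \bar R :=
  max_function ok A (fun y => s y * mu y)%R (fun y => g y * ((s y)^-1)%:E).

(** Multiply the average of [g] over [A i] to the power [r] by the Muckenhoupt
    condition: what appears is the average over [A i] of the function
    [M (g / s) `^ r / w], for the measure [w mu]. *)
Lemma max_function_dominated (g : T -> \bar R) (x : T) : (forall y, 0 <= g y) ->
  max_function ok A mu g x <=
  (K%:E * max_function ok A (fun y => w y * mu y)%R
     (fun y => dual_max g y `^ r * ((w y)^-1)%:E) x) `^ r^-1.
Proof.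
move=> g0; set M := dual_max g; apply: ge_ereal_sup => _ [i [oki Aix] <-].
have [W [S [m [WE SE mE H]]]] := ws (imageP A oki).
have wmu0 y : (0 < w y * mu y)%R by rewrite mulr_gt0.
have W0 : (0 < W)%R by rewrite -lte_fin -WE msr_gt0//; exact: A_neq0.
have S0 : (0 < S)%R by rewrite -lte_fin -SE msr_gt0//; exact: A_neq0.
have m0 : (0 < m)%R.
  rewrite -lte_fin -mE; apply: lt_le_trans (ge_esum_point Aix _).
    by rewrite lte_fin.
  by move=> y; rewrite lee_fin ltW.
set G := \esum_(y in A i) (g y * (mu y)%:E).
have G0 : 0 <= G by apply: esum_ge0 => y _; rewrite mule_ge0// lee_fin ltW.
pose a := G / S%:E.
have SV : (S%:E)^-1 = (S^-1)%:E by rewrite inver gt_eqF.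
have mV : (m%:E)^-1 = (m^-1)%:E by rewrite inver gt_eqF.
have WV : (W%:E)^-1 = (W^-1)%:E by rewrite inver gt_eqF.
have a0 : 0 <= a by rewrite mule_ge0// SV lee_fin invr_ge0 ltW.
have aM y : A i y -> a <= M y.
  move=> Aiy; apply: ereal_sup_ubound; exists i => //.
  rewrite SE; congr (_ / _); apply: eq_esum => z _.
  by rewrite -muleA -EFinM mulrA mulVf ?gt_eqF// mul1r.
have avg : a `^ r * (m / W)%:E <= max_function ok A (fun y => w y * mu y)%R
     (fun y => M y `^ r * ((w y)^-1)%:E) x.
  apply: (@le_trans _ _ ((\esum_(y in A i)
      (M y `^ r * ((w y)^-1)%:E * (w y * mu y)%:E)) / W%:E)); last first.
    by apply: ereal_sup_ubound; exists i; [|rewrite WE].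
  rewrite WV EFinM muleA; apply: lee_wpmul2r; first by rewrite lee_fin invr_ge0 ltW.
  rewrite -mE; apply: le_trans (ge0_le_esumZl _ _ _) _.
  - exact: poweR_ge0.
  - by move=> y; rewrite lee_fin ltW.
  - apply: le_esum => y Aiy; rewrite -muleA -EFinM mulrA mulVf ?gt_eqF// mul1r.
    apply: lee_wpmul2r; first by rewrite lee_fin ltW.
    by apply: le_poweR; [exact: ltW| |exact: aM].
have -> : G / (\esum_(y in A i) (mu y)%:E) = (((G / m%:E) `^ r) `^ r^-1).
  rewrite mE -poweRrM divff ?gt_eqF// poweRe1// mule_ge0// mV lee_fin.
  by rewrite invr_ge0 ltW.
apply: le_poweR; [by rewrite invr_ge0 ltW|exact: poweR_ge0|].
apply: le_trans (lee_wpmul2l _ avg); last by rewrite lee_fin.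
have -> : G / m%:E = a * (S / m)%:E.
  by rewrite /a mV SV -muleA -EFinM; congr (_ * _%:E); field; rewrite !gt_eqF.
rewrite poweRM//; last by rewrite lee_fin divr_ge0// ltW.
rewrite muleCA; apply: lee_wpmul2l; first exact: poweR_ge0.
rewrite poweR_EFin -EFinM lee_fin.
rewrite powRM ?invr_ge0 ?(ltW S0) ?(ltW m0)//.
rewrite mulrA ler_pdivlMr// -powR_inv1 ?(ltW m0)// -powRrM mulN1r powRN.
rewrite mulrAC ler_pdivrMr ?powR_gt0// mulrC.
move: H; rewrite powRD ?(gt_eqF m0) ?implybT// powRr1 ?(ltW m0)//.
by rewrite mulrA => /le_trans; apply; rewrite le_eqVlt mulrAC eqxx.
Qed.

End PointwiseDomination.

(** * Maximal functions over trapezoids *)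

Section TrapezoidMaximal.
Context (T : tree) (omega : set (nat -> T)) (homega : boundary T omega).
Context (R : realType) (o : T) (mu : T -> R) (hmu : flow_measure omega o mu).
Context (beta : R) (hbeta : 4 <= beta).

Local Notation Mx := (max_function (@valid T R beta) (trap_of omega)).
Local Open Scope ereal_scope.

Lemma maximalE f x : maximal omega beta mu f x = Mx mu (fun y => `|f y|%:E) x.
Proof.
congr ereal_sup; apply/seteqP; split=> z /=.
  move=> [E [/(trapezoidsP homega)[i vi ->] Ex] <-]; exists i => //.
move=> [i [vi Aix] <-]; exists (trap_of omega i) => //; split=> //.
by apply/(trapezoidsP homega); exists i.
Qed.

Lemma max_function_ge0 (nu : T -> R) g x : (forall y, 0 < nu y)%R ->
  (forall y, 0 <= g y) -> 0 <= Mx nu g x.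
Proof.
move=> nu0 g0; pose i : trap_index T := (x, 0%N, 1%N).
apply: (@le_trans _ _ ((\esum_(y in trap_of omega i) (g y * (nu y)%:E)) /
    (\esum_(y in trap_of omega i) (nu y)%:E))).
  rewrite mule_ge0 ?inve_ge0//; apply: esum_ge0 => y _.
    by rewrite mule_ge0// lee_fin ltW.
  by rewrite lee_fin ltW.
apply: ereal_sup_ubound; exists i => //; split; first by right.
by rewrite /trap_of trap01.
Qed.

Section Weight.
Context (nu : T -> R) (nu_gt0 : forall x, (0 < nu x)%R) (D : R) (D0 : (0 <= D)%R).
Hypothesis nu_fin : forall Q, trapezoids omega beta Q -> mass nu Q < +oo.
Hypothesis doubling : forall Q E, trapezoids omega beta Q -> E `<=` Q ->
  mass mu Q <= 3%:E * mass mu E -> mass nu Q <= D%:E * mass nu E.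

(** The level of the root serves as the rank: of two comparable roots, it is
    the higher one whose trapezoid has to be dilated. *)
Lemma trap_Vitali : exists (S : trap_index T -> set T) (K : R),
  [/\ (0 <= K)%R,
    forall i j, valid beta i -> valid beta j ->
      (level R omega o (apex j) <= level R omega o (apex i))%R ->
      trap_of omega i `&` trap_of omega j !=set0 -> trap_of omega j `<=` S i &
    forall i, valid beta i -> mass nu (S i) <= K%:E * mass nu (trap_of omega i)].
Proof.
have [N hN] : exists N : nat, (beta <= (2 ^ N)%:R)%R.
  exists (Num.trunc beta).+1; apply: (@le_trans _ _ (Num.trunc beta).+1%:R).
    exact: ltW (truncnS_gt _).
  by rewrite ler_nat ltnW// ltn_expl.
exists (dilate omega N), ((1 + D) ^+ (3 * N).+1)%R; split.
- by rewrite exprn_ge0// addr_ge0.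
- by move=> i j vi vj; exact: (trap_covering homega hN vi vj).
- by move=> i vi; exact: (mass_dilate homega hmu hN hbeta nu_gt0 D0 doubling vi).
Qed.

Let valid_fin i : valid beta i -> mass nu (trap_of omega i) < +oo.
Proof. by move=> vi; apply: nu_fin; apply/(trapezoidsP homega); exists i. Qed.

Lemma max_function_weak : exists2 C : R, (0 <= C)%R &
  forall (g : T -> \bar R) (t : R), (forall x, 0 <= g x) -> (0 <= t)%R ->
  t%:E * mass nu [set x | t%:E < Mx nu g x] <=
  C%:E * (\esum_(x in setT) (g x * (nu x)%:E)).
Proof.
have [S [K [K0 cov dil]]] := trap_Vitali; exists K => // g t g0 t0.
exact: (weak_type nu_gt0 (trap_of_neq0 homega hmu (beta:=beta)) valid_fin cov
  K0 dil g0 t0).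
Qed.

Lemma max_function_strong (q : R) : (1 < q)%R -> exists2 C : R, (0 <= C)%R &
  forall (g : T -> \bar R), (forall x, 0 <= g x) ->
  \esum_(x in setT) (Mx nu g x `^ q * (nu x)%:E) <=
  C%:E * (\esum_(x in setT) (g x `^ q * (nu x)%:E)).
Proof.
move=> q1; have [S [K [K0 cov dil]]] := trap_Vitali.
exists ((2 * expR 1) `^ q * K * (1 - expR (- (q - 1)))^-1)%R.
  rewrite !mulr_ge0 ?powR_ge0// invr_ge0 subr_ge0 -[leRHS]expR0 ler_expR; lra.
move=> g g0; apply: interpolation => // [x|t t0]; first exact: max_function_ge0.
exact: (weak_type_above nu_gt0 (trap_of_neq0 homega hmu (beta:=beta)) valid_fin cov
  K0 dil g0 t0).
Qed.
End Weight.
End TrapezoidMaximal.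

(** * Characterization of the weights *)

Section Characterization.
Context (R : realType) (T : tree) (omega : set (nat -> T)).
Context (homega : boundary T omega) (o : T) (mu : T -> R).
Context (hmu : flow_measure omega o mu) (beta : R) (hbeta : 12 <= beta).
Context (w : T -> R) (hw : weight w).

Local Notation nu := (fun y => w y * mu y).
Local Notation F := (trapezoids omega beta).
Local Notation Mx := (max_function (@valid T R beta) (trap_of omega)).
Local Open Scope ereal_scope.

Let mu0 x : (0 < mu x)%R. Proof. exact: mu_gt0 hmu x. Qed.
Let w0 x : (0 < w x)%R. Proof. exact: hw. Qed.
Let nu0 x : (0 < nu x)%R. Proof. by rewrite mulr_gt0. Qed.
Let beta4 : (4 <= beta)%R. Proof. by apply: le_trans hbeta; lra. Qed.

Let F_gt0 Q : F Q -> 0 < mass mu Q.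
Proof.
by move=> /(trapezoidsP homega)[i vi ->]; exact: (mass_valid_gt0 homega hmu vi).
Qed.

Let F_fin Q : F Q -> mass mu Q < +oo.
Proof.
by move=> /(trapezoidsP homega)[i vi ->]; exact: (mass_valid_fin homega hmu vi).
Qed.

Let F_real Q : F Q -> exists2 m : R, (0 < m)%R & mass mu Q = m%:E.
Proof.
move=> FQ; exists (fine (mass mu Q)).
  by apply: fine_gt0; rewrite F_gt0// F_fin.
by rewrite fineK// gt0_fin_numE ?F_gt0// F_fin.
Qed.

Let F_neq0 Q : F Q -> Q !=set0.
Proof. by move=> /F_gt0 /vol_neq0. Qed.

Let F_trap : F = [set trap_of omega i | i in valid beta].
Proof.
apply/seteqP; split=> Q; first by move=> /(trapezoidsP homega)[i vi ->]; exists i.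
by move=> [i vi <-]; apply/(trapezoidsP homega); exists i.
Qed.

Let maximal_ge f x Q : F Q -> Q x ->
  (\esum_(y in Q) (`|f y| * mu y)%:E) / mass mu Q <= maximal omega beta mu f x.
Proof. by move=> FQ Qx; apply: ereal_sup_ubound; exists Q. Qed.

Let maximal_ge0 f x : 0 <= maximal omega beta mu f x.
Proof. by rewrite (maximalE homega); apply: max_function_ge0. Qed.

Lemma mean_real (v : T -> R) (V m : R) Q : (0 < m)%R ->
  mass (fun y => v y * mu y)%R Q = V%:E -> mass mu Q = m%:E ->
  mean mu v Q = (V / m)%:E.
Proof. by move=> m0 vE mE; rewrite /mean vE mE inver gt_eqF. Qed.

Section Strong.
Context (p : R) (p1 : (1 < p)%R).
Local Notation r := (p - 1)%R.
Local Notation s := (fun y => w y `^ (- r^-1))%R.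

Let r0 : (0 < r)%R. Proof. by rewrite subr_gt0. Qed.
Let p0 : (0 < p)%R. Proof. exact: lt_trans p1. Qed.
Let s0 x : (0 < s x)%R. Proof. by rewrite powR_gt0. Qed.
Let smu0 x : (0 < s x * mu x)%R. Proof. by rewrite mulr_gt0. Qed.

Let sp_w x : (s x `^ p * w x = s x)%R.
Proof.
have e : (- r^-1 * p + 1 = - r^-1)%R by field; rewrite gt_eqF.
by rewrite -powRrM -{2}[w x]powRr1 ?(ltW (w0 x))// -powRD ?e// (gt_eqF (w0 x)) implybT.
Qed.

Lemma Ap_constP : Ap_const omega beta mu p w < +oo <->
  exists2 K : R, (0 <= K)%R & muckenhoupt mu F r K w s.
Proof.
split=> [Aoo|[K K0 wF]]; last first.
  apply: (@le_lt_trans _ _ K%:E); last exact: ltry.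
  apply: ge_ereal_sup => _ [Q FQ <-]; have [m m0 mE'] := F_real FQ.
  have [W [S [m' [WE SE mE H]]]] := wF Q FQ.
  have mm : m' = m by move: mE; rewrite -/(mass mu Q) mE' => -[->].
  rewrite {}mm in mE H.
  have W0 : (0 <= W)%R by rewrite -lee_fin -WE esum_ge0// => y _; rewrite lee_fin ltW.
  have S0 : (0 <= S)%R by rewrite -lee_fin -SE esum_ge0// => y _; rewrite lee_fin ltW.
  rewrite (mean_real m0 WE mE) (mean_real m0 SE mE) poweR_EFin -EFinM lee_fin.
  rewrite powRM ?invr_ge0 ?(ltW m0)// -powR_inv1 ?(ltW m0)// -powRrM mulN1r powRN.
  rewrite mulrACA -powRN -powRD ?(gt_eqF m0) ?implybT// -opprD powRN (addrC 1%R).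
  by rewrite ler_pdivrMr ?powR_gt0.
have A0 : 0 <= Ap_const omega beta mu p w.
  apply: le_trans (_ : mean mu w [set o] * mean mu s [set o] `^ r <= _).
    by rewrite !mule_ge0 ?poweR_ge0 ?inve_ge0// esum_ge0// => y _; rewrite lee_fin ltW.
  by apply: ereal_sup_ubound; exists [set o] => //; right; exists o.
exists (fine (Ap_const omega beta mu p w)); first exact: fine_ge0.
move=> Q FQ; have [m m0 mE] := F_real FQ.
have AQ : mean mu w Q * mean mu s Q `^ r <= Ap_const omega beta mu p w.
  by apply: ereal_sup_ubound; exists Q.
have mean_gt0 (v : T -> R) : (forall x, 0 < v x)%R -> 0 < mean mu v Q.
  move=> v0; rewrite /mean mE inver gt_eqF// mule_gt0 ?lte_fin ?invr_gt0//.
  by apply: msr_gt0 => //; exact: F_neq0.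
have fin (v : T -> R) : (forall x, 0 < v x)%R -> mean mu v Q < +oo ->
    exists2 V : R, (0 < V)%R & mass (fun y => v y * mu y)%R Q = V%:E.
  move=> v0; have : 0 < mass (fun y => v y * mu y)%R Q.
    by apply: msr_gt0 => //; exact: F_neq0.
  rewrite /mean mE inver gt_eqF//; case: (mass _ Q) => [V V0 _| _|]//.
    by exists V; rewrite // -lte_fin.
  by rewrite gt0_mulye ?ltxx// lte_fin invr_gt0.
have [W W0 WE] : exists2 W : R, (0 < W)%R & mass nu Q = W%:E.
  apply: fin => //; rewrite ltNge leye_eq; apply/negP => /eqP e.
  move: AQ; rewrite e gt0_mulye ?poweR_gt0 ?mean_gt0// leye_eq => /eqP Ay.
  by rewrite Ay ltxx in Aoo.
have [S S0 SE] : exists2 S : R, (0 < S)%R & mass (fun y => s y * mu y)%R Q = S%:E.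
  apply: fin => //; rewrite ltNge leye_eq; apply/negP => /eqP e.
  move: AQ; rewrite e poweRyr ?(gt_eqF r0)// gt0_muley ?mean_gt0// leye_eq => /eqP Ay.
  by rewrite Ay ltxx in Aoo.
exists W, S, m; split=> //.
move: AQ; rewrite (mean_real m0 WE mE) (mean_real m0 SE mE) poweR_EFin -EFinM.
rewrite -{1}[Ap_const _ _ _ _ _]fineK ?ge0_fin_numE// lee_fin.
rewrite powRM ?invr_ge0 ?(ltW m0) ?(ltW S0)//.
rewrite -powR_inv1 ?(ltW m0)// -powRrM mulN1r powRN.
rewrite mulrACA -powRN -powRD ?(gt_eqF m0) ?implybT// -opprD powRN (addrC 1%R).
by rewrite ler_pdivrMr ?powR_gt0.
Qed.

(** Testing on [s] restricted to a finite subset [X] of [Q], for which the norm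
    is finite from the start; a singleton [X] shows that [w] has finite mass on
    [Q], and then the supremum over [X] gives the condition. *)
Lemma Ap_necessary : strong_bounded nu p (maximal omega beta mu) ->
  exists2 K : R, (0 <= K)%R & muckenhoupt mu F r K w s.
Proof.
move=> [C C0 bound]; exists (C `^ p)%R; first exact: powR_ge0.
move=> Q FQ; have [m m0 mE] := F_real FQ.
have test X V : finite_set X -> X `<=` Q -> \esum_(y in X) (s y * mu y)%:E = V%:E ->
    ((V / m) `^ p)%:E * mass nu Q <= (C `^ p * V)%:E.
  move=> finX XQ VE; have V0 : (0 <= V)%R.
    by rewrite -lee_fin -VE esum_ge0// => y _; rewrite lee_fin ltW.
  pose f y := if y \in X then s y else 0%R.
  have f0 y : (0 <= f y)%R by rewrite /f; case: ifP => // _; rewrite ltW.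
  have normf : \esum_(y in setT) (`|(EFin \o f) y| `^ p * (nu y)%:E) = V%:E.
    rewrite -VE [RHS]esum_mkcond; apply: eq_esum => y _ /=.
    rewrite ger0_norm// -EFinM /f; case: ifP => _.
      by rewrite mulrA sp_w.
    by rewrite powR0 ?mul0r ?gt_eqF.
  have fM y : Q y -> (V / m)%:E <= maximal omega beta mu f y.
    move=> Qy; apply: le_trans (maximal_ge f FQ Qy).
    rewrite mE inver gt_eqF// EFinM; apply: lee_wpmul2r.
      by rewrite lee_fin invr_ge0 ltW.
    rewrite -VE -[X in esum X _](setIidr XQ) esum_mkcondr.
    by apply: le_esum => z _; rewrite ger0_norm// /f; case: ifP => //; rewrite mul0r.
  have := bound f; rewrite /Lp_norm normf poweR_EFin ltry => /(_ isT) Mf.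
  have : \esum_(x in setT) (`|maximal omega beta mu f x| `^ p * (nu x)%:E) <=
      (C `^ p * V)%:E.
    set L := esum _ _ in Mf *.
    have L0 : 0 <= L by apply: esum_ge0 => y _; rewrite mule_ge0 ?poweR_ge0// lee_fin ltW.
    have -> : L = (L `^ p^-1) `^ p by rewrite -poweRrM mulVf ?gt_eqF// poweRe1.
    apply: le_trans (le_poweR (ltW p0) (poweR_ge0 _ _) Mf) _.
    rewrite -EFinM poweR_EFin lee_fin powRM ?powR_ge0// -powRrM mulVf ?gt_eqF//.
    by rewrite powRr1.
  apply: le_trans; rewrite -esumZl ?powR_ge0//; last by move=> y _; rewrite lee_fin ltW.
  rewrite [leLHS]esum_mkcond; apply: le_esum => y _; case: ifPn => [yQ|_]; last first.
    by rewrite mule_ge0 ?poweR_ge0// lee_fin ltW.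
  apply: lee_wpmul2r; first by rewrite lee_fin ltW.
  rewrite -poweR_EFin; apply: le_poweR; rewrite ?lee_fin ?divr_ge0 ?(ltW p0) ?(ltW m0)//.
  by rewrite gee0_abs//; apply: fM; rewrite -in_setE.
have [x Qx] := F_neq0 FQ.
have W0 : 0 < mass nu Q by apply: msr_gt0 => //; exists x.
have [W WE] : exists W, mass nu Q = W%:E.
  have := @test [set x] (s x * mu x)%R (finite_set1 x).
  rewrite sub1set inE esum_set1 ?lee_fin ?(ltW (smu0 x))// => /(_ Qx erefl).
  case: (mass nu Q) W0 => [W _ _||]//; first by exists W.
  rewrite gt0_muley ?lte_fin ?powR_gt0 ?divr_gt0//.
rewrite WE lte_fin in W0.
pose B := ((C `^ p * m `^ p / W) `^ r^-1)%R.
have VB X V : finite_set X -> X `<=` Q -> \esum_(y in X) (s y * mu y)%:E = V%:E ->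
    (V <= B)%R.
  move=> finX XQ VE; have := test X V finX XQ VE.
  have : (0 <= V)%R.
    by rewrite -lee_fin -VE esum_ge0// => y _; rewrite lee_fin ltW.
  rewrite le_eqVlt => /predU1P[<- _|V0]; first exact: powR_ge0.
  rewrite WE -EFinM lee_fin => VW.
  have -> : V = ((V `^ r) `^ r^-1)%R by rewrite -powRrM divff ?gt_eqF// powRr1// ltW.
  apply: ge0_ler_powR; rewrite ?invr_ge0 ?nnegrE ?powR_ge0 ?divr_ge0 ?mulr_ge0
    ?powR_ge0 ?(ltW r0) ?(ltW W0)//.
  rewrite ler_pdivlMr// -(@ler_pM2r _ V)//.
  rewrite mulrAC (mulrC _ V) mulr_powRB1 ?(ltW V0)//.
  rewrite powRM ?invr_ge0 ?(ltW V0) ?(ltW m0)// in VW.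
  rewrite -powR_inv1 ?(ltW m0)// -powRrM mulN1r powRN in VW.
  by rewrite mulrAC ler_pdivrMr ?powR_gt0// in VW; rewrite (mulrAC (C `^ p)%R).
have SB : mass (fun y => s y * mu y)%R Q <= B%:E.
  apply: ge_ereal_sup => _ [X [finX XQ] <-].
  rewrite -esum_fset//; last by move=> y _; rewrite lee_fin ltW.
  have VE : \esum_(y in X) (s y * mu y)%:E = (\sum_(y \in X) (s y * mu y))%R%:E.
    rewrite esum_fset//; last by move=> y _; rewrite lee_fin ltW.
    by rewrite !fsbig_finite// sumEFin.
  by rewrite [leLHS]VE lee_fin; exact: VB VE.
have S0 : 0 < mass (fun y => s y * mu y)%R Q by apply: msr_gt0 => //; exists x.
have [S SE] : exists S, mass (fun y => s y * mu y)%R Q = S%:E.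
  by case: (mass _ Q) SB S0 => [S| |]//; exists S.
rewrite SE lee_fin in SB; rewrite SE lte_fin in S0.
exists W, S, m; split=> //.
rewrite subrK mulrC -ler_pdivlMr//.
have -> : (C `^ p * m `^ p / W = B `^ r)%R.
  by rewrite -powRrM mulVf ?gt_eqF// powRr1// divr_ge0 ?mulr_ge0 ?powR_ge0// ltW.
by apply: ge0_ler_powR; rewrite ?nnegrE ?powR_ge0 ?(ltW r0) ?(ltW S0).
Qed.

(** The exponents match because [q = p / (p - 1)] is such that
    [(M `^ (p - 1) / w) `^ q * w = M `^ p * s] and [(f / s) `^ p * s = f `^ p * w]. *)
Lemma Ap_sufficient K : (0 <= K)%R -> muckenhoupt mu F r K w s ->
  strong_bounded nu p (maximal omega beta mu).
Proof.
move=> K0 wF.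
have ws : muckenhoupt mu [set trap_of omega i | i in valid beta] r K w s.
  by rewrite -F_trap.
have fin Q : F Q -> mass nu Q < +oo /\ mass (fun y => s y * mu y)%R Q < +oo.
  by move=> /wF[W [S [m [WE SE _ _]]]]; rewrite /mass WE SE !ltry.
have rV0 : (0 < r^-1)%R by rewrite invr_gt0.
pose q := (p / r)%R.
have q1 : (1 < q)%R by rewrite ltr_pdivlMr// mul1r; lra.
have qE : (q - 1 = r^-1)%R by rewrite /q; field; rewrite gt_eqF.
have [C1 C10 max1] := max_function_strong homega hmu beta4 nu0
  (mulr_ge0 K0 (powR_ge0 _ _)) (fun Q FQ => (fin Q FQ).1)
  (fun Q E FQ EQ => muckenhoupt_doubling mu0 F_gt0 r0 K0 w0 (fun=> erefl) wF FQ EQ)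
  q1.
have s_dual x : w x = (s x `^ (- (r^-1)^-1))%R.
  by rewrite -powRrM invrK mulrNN mulVf ?gt_eqF// powRr1// ltW.
have [C2 C20 max2] := max_function_strong homega hmu beta4 smu0
  (mulr_ge0 (powR_ge0 _ _) (powR_ge0 _ _)) (fun Q FQ => (fin Q FQ).2)
  (fun Q E FQ EQ => muckenhoupt_doubling mu0 F_gt0 rV0 (powR_ge0 _ _) s0 s_dual
    (muckenhoupt_dual mu0 F_gt0 r0 K0 w0 s0 wF) FQ EQ) p1.
exists ((K `^ q * C1 * C2) `^ p^-1)%R; first exact: powR_ge0.
move=> f _; rewrite /Lp_norm.
pose g y := `|f y|%:E; have g0 y : 0 <= g y by rewrite lee_fin.
pose gs y := g y * ((s y)^-1)%:E.
have gs0 y : 0 <= gs y by rewrite mule_ge0// lee_fin invr_ge0 ltW.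
pose M2 := Mx (fun y => s y * mu y)%R gs.
have M20 y : 0 <= M2 y by apply: max_function_ge0.
pose h y := M2 y `^ r * ((w y)^-1)%:E.
have h0 y : 0 <= h y by rewrite mule_ge0 ?poweR_ge0// lee_fin invr_ge0 ltW.
pose M1 := Mx nu h.
have M10 y : 0 <= M1 y by apply: max_function_ge0.
have Kq : 0 <= (K `^ q)%:E by rewrite lee_fin powR_ge0.
have nuE y : 0 <= (nu y)%:E by rewrite lee_fin ltW.
set L := \esum_(x in setT) (`|maximal omega beta mu f x| `^ p * (nu x)%:E).
set N := \esum_(x in setT) (`|(EFin \o f) x| `^ p * (nu x)%:E).
have N0 : 0 <= N by apply: esum_ge0 => y _; rewrite mule_ge0 ?poweR_ge0.
suff LN : L <= (K `^ q * C1 * C2)%:E * N.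
  rewrite -poweR_EFin -poweRM ?lee_fin ?mulr_ge0 ?powR_ge0//.
  apply: le_poweR => //; first by rewrite invr_ge0 ltW.
  by apply: esum_ge0 => y _; rewrite mule_ge0 ?poweR_ge0.
have step1 : L <= (K `^ q)%:E * (\esum_(x in setT) (M1 x `^ q * (nu x)%:E)).
  rewrite -esumZl ?powR_ge0//; last by move=> y _; rewrite mule_ge0 ?poweR_ge0.
  apply: le_esum => x _; rewrite muleA; apply: lee_wpmul2r => //.
  rewrite gee0_abs// -poweR_EFin -poweRM ?lee_fin// /q mulrC poweRrM.
  apply: le_poweR => //; first exact: ltW.
  rewrite (maximalE homega).
  apply: (max_function_dominated mu0 w0 s0 r0 K0
    (trap_of_neq0 homega hmu (beta:=beta)) ws).
  exact: g0.
have step2 : \esum_(x in setT) (h x `^ q * (nu x)%:E) =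
    \esum_(x in setT) (M2 x `^ p * (s x * mu x)%:E).
  apply: eq_esum => x _; rewrite /h poweRM ?poweR_ge0//; last first.
    by rewrite lee_fin invr_ge0 ltW.
  rewrite -poweRrM (_ : r * q = p)%R; last by rewrite /q; field; rewrite gt_eqF.
  rewrite -muleA; congr (_ * _); rewrite poweR_EFin -EFinM mulrA; congr (_ * _)%:E.
  rewrite -powR_inv1 ?(ltW (w0 x))// -powRrM mulN1r -{2}[w x]powRr1 ?(ltW (w0 x))//.
  rewrite -powRD ?(gt_eqF (w0 x)) ?implybT//; congr (_ `^ _)%R.
  by rewrite -qE; ring.
have step3 : \esum_(x in setT) (gs x `^ p * (s x * mu x)%:E) = N.
  apply: eq_esum => x _; rewrite /gs -EFinM !poweR_EFin -!EFinM /=.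
  rewrite powRM ?invr_ge0 ?(ltW (s0 x))//; congr (_%:E).
  rewrite -mulrA mulrA -mulrA; congr (_ * _)%R; rewrite mulrA; congr (_ * _)%R.
  rewrite -powR_inv1 ?(ltW (s0 x))// -powRrM mulN1r.
  rewrite -{2}[(w x `^ _)%R]powRr1 ?(ltW (s0 x))//.
  rewrite -powRD ?(gt_eqF (s0 x)) ?implybT// [RHS]s_dual; congr (_ `^ _)%R.
  by rewrite invrK; ring.
apply: (le_trans step1); rewrite !EFinM -!muleA; apply: lee_wpmul2l => //.
apply: le_trans (max1 h h0) _; apply: lee_wpmul2l; first by rewrite lee_fin.
by rewrite step2 -step3; exact: max2.
Qed.

End Strong.

Section Weak.

(** Every point has positive mass, so the essential supremum of [1 / w] in the
    condition A_1 is a supremum, and the condition can be read pointwise. *)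
Definition A1_bound (K : R) :=
  forall Q x, F Q -> Q x -> mass nu Q <= (K * w x)%:E * mass mu Q.

Let mass_nu_gt0 Q x : Q x -> 0 < mass nu Q.
Proof. by move=> Qx; apply: msr_gt0 => //; exists x. Qed.

Lemma A1_constP : A1_const omega beta mu w < +oo <->
  exists2 K : R, (0 < K)%R & A1_bound K.
Proof.
split=> [Aoo|[K K0 wF]]; last first.
  apply: (@le_lt_trans _ _ K%:E); last exact: ltry.
  apply: ge_ereal_sup => _ [Q FQ <-]; have [m m0 mE] := F_real FQ.
  have [x Qx] := F_neq0 FQ.
  have [W W0 WE] : exists2 W : R, (0 < W)%R & mass nu Q = W%:E.
    have := wF Q x FQ Qx; rewrite mE -EFinM.
    have := mass_nu_gt0 Qx; case: (mass nu Q) => [W| |]// W0 _.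
    by exists W.
  have -> : K%:E = mean mu w Q * (K * m / W)%:E.
    by rewrite (mean_real m0 WE mE) -EFinM; congr (_%:E); field; rewrite !gt_eqF.
  apply: lee_wpmul2l; first by rewrite (mean_real m0 WE mE) lee_fin divr_ge0 ?ltW.
  apply: ereal_inf_lbound; exists (K * m / W)%R => //; split.
    by rewrite divr_ge0 ?mulr_ge0 ?ltW.
  rewrite (_ : _ `&` _ = set0) ?/mass ?esum_set0//.
  apply/seteqP; split=> // y [Qy /=]; apply/negP; rewrite -leNgt.
  have := wF Q y FQ Qy; rewrite WE mE -EFinM lee_fin => Wm.
  rewrite ger0_norm ?invr_ge0 ?(ltW (w0 y))//.
  by rewrite ler_pdivlMr// mulrC ler_pdivrMr// mulrAC.
have lower Q y : Q y -> ((w y)^-1)%:E <= Linfty_norm mu Q (fun y => (w y)^-1)%R.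
  move=> Qy; apply: le_ereal_inf_tmp => _ [M [M0 zero] <-].
  rewrite lee_fin leNgt; apply/negP => My.
  have : (mu y)%:E <= 0 :> \bar R.
    rewrite -zero; apply: ge_esum_point => [|z]; last by rewrite lee_fin ltW.
    by split=> //=; rewrite ger0_norm// invr_ge0 ltW.
  by rewrite lee_fin leNgt mu0.
have A_ge Q : F Q -> mean mu w Q * Linfty_norm mu Q (fun y => (w y)^-1)%R <=
    A1_const omega beta mu w.
  by move=> FQ; apply: ereal_sup_ubound; exists Q.
have AQ Q y : F Q -> Q y ->
    mean mu w Q * ((w y)^-1)%:E <= A1_const omega beta mu w.
  move=> FQ Qy; apply: le_trans (A_ge Q FQ); apply: lee_wpmul2l; last exact: lower.
  by rewrite mule_ge0 ?inve_ge0// esum_ge0// => z _; rewrite lee_fin ltW.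
have A0 : 0 <= A1_const omega beta mu w.
  apply: le_trans (AQ [set o] o _ erefl); last by right; exists o.
  rewrite mule_ge0 ?lee_fin ?invr_ge0 ?(ltW (w0 o))//.
  by rewrite mule_ge0 ?inve_ge0// esum_ge0// => z _; rewrite lee_fin ltW.
exists (fine (A1_const omega beta mu w) + 1)%R.
  by rewrite ltr_wpDl// fine_ge0.
move=> Q y FQ Qy; have [m m0 mE] := F_real FQ.
have := AQ Q y FQ Qy; rewrite /mean mE inver gt_eqF// -muleA -EFinM.
rewrite -[leRHS]fineK ?ge0_fin_numE//.
rewrite (_ : (m^-1 * (w y)^-1)%R = ((w y * m)^-1)%R); last first.
  by field; rewrite !gt_eqF.
rewrite lee_pdivrMr ?mulr_gt0// -!EFinM mulrA => H.
apply: le_trans H _.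
by rewrite lee_fin ler_wpM2r ?(ltW m0)// ler_wpM2r ?(ltW (w0 y))// lerDl.
Qed.

(** The maximal function of the indicator function of [x] is at least
    [mu x / mu Q] on [Q]; half of this value is a level below it on all of
    [Q]. *)
Lemma A1_necessary : weak_bounded nu 1 (maximal omega beta mu) ->
  exists2 K : R, (0 < K)%R & A1_bound K.
Proof.
move=> [C C0 bound]; exists (2 * C + 1)%R; first by rewrite ltr_wpDl// mulr_ge0.
move=> Q x FQ Qx; have [m m0 mE] := F_real FQ.
pose f y := ((y == x)%:R : R).
have normf : Lp_norm nu 1 (EFin \o f) = (w x * mu x)%:E.
  rewrite /Lp_norm invr1 poweRe1; last by apply: esum_ge0 => y _;
    rewrite mule_ge0 ?poweR_ge0// lee_fin ltW.
  rewrite -[RHS](@esum_set1 R T x (fun y => (nu y)%:E)) ?lee_fin ?ltW//.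
  rewrite [RHS]esum_mkcond; apply: eq_esum => y _ /=.
  rewrite powRr1// -EFinM /f; case: ifPn => [|yx].
    by rewrite inE /= => ->; rewrite eqxx normr1 mul1r.
  rewrite (_ : (y == x) = false) ?normr0 ?mul0r//.
  by apply/negbTE; apply: contraNN yx => /eqP ->; rewrite inE.
have := bound f; rewrite normf ltry => /(_ isT) weak.
pose t := (mu x / m / 2)%R.
have t0 : (0 < t)%R by rewrite !divr_gt0.
have : t%:E * mass nu [set y | t%:E < `|maximal omega beta mu f y|] <=
    C%:E * (w x * mu x)%:E.
  apply: le_trans weak; apply: ereal_sup_ubound; exists t => //.
  by rewrite invr1 poweRe1// esum_ge0// => y _; rewrite lee_fin ltW.
have sub : Q `<=` [set y | t%:E < `|maximal omega beta mu f y|].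
  move=> y Qy /=; rewrite gee0_abs//; apply: lt_le_trans (maximal_ge f FQ Qy).
  apply: (@lt_le_trans _ _ ((mu x)%:E / mass mu Q)).
    rewrite mE inver gt_eqF// -EFinM lte_fin /t ltr_pdivrMr// ltr_pMr ?divr_gt0//.
    by rewrite ltr1n.
  apply: lee_wpmul2r; first by rewrite inve_ge0 ltW// F_gt0.
  apply: le_trans (ge_esum_point Qx _); last by move=> z; rewrite lee_fin mulr_ge0// ltW.
  by rewrite /f eqxx normr1 mul1r.
move=> tM; have : t%:E * mass nu Q <= C%:E * (w x * mu x)%:E.
  apply: le_trans tM; apply: lee_wpmul2l; first by rewrite lee_fin ltW.
  by apply: le_esum_set => // y _; rewrite lee_fin ltW.
rewrite -lee_pdivlMl// -!EFinM => H; rewrite mE -EFinM; apply: le_trans H _.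
rewrite lee_fin (_ : t^-1 * _ = 2 * C * w x * m)%R; last first.
  by rewrite /t; field; rewrite !gt_eqF.
by rewrite ler_wpM2r ?(ltW m0)// ler_wpM2r ?(ltW (w0 x))// lerDl.
Qed.

(** Sum the pointwise bound over [E]. *)
Lemma A1_doubling K : (0 < K)%R -> A1_bound K -> forall Q E, F Q -> E `<=` Q ->
  mass mu Q <= 3%:E * mass mu E -> mass nu Q <= (3 * K)%:E * mass nu E.
Proof.
move=> K0 wF Q E FQ EQ QE.
have [m m0 mE] := F_real FQ; have [x Qx] := F_neq0 FQ.
have [W W0 WE] : exists2 W : R, (0 < W)%R & mass nu Q = W%:E.
  have := wF Q x FQ Qx; rewrite mE -EFinM.
  have := mass_nu_gt0 Qx; case: (mass nu Q) => [W| |]// W0 _.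
  by exists W.
have main : (W / (K * m))%:E * mass mu E <= mass nu E.
  rewrite -esumZl; last 2 first.
  - by rewrite divr_ge0 ?mulr_ge0 ?ltW.
  - by move=> y _; rewrite lee_fin ltW.
  apply: le_esum => y Ey; rewrite -EFinM lee_fin ler_wpM2r ?(ltW (mu0 y))//.
  have := wF Q y FQ (EQ y Ey); rewrite WE mE -EFinM lee_fin => H.
  by rewrite ler_pdivrMr ?mulr_gt0// mulrA (mulrC (w y)).
apply: le_trans (lee_wpmul2l _ main); last by rewrite lee_fin mulr_ge0// ltW.
rewrite muleA -EFinM (_ : 3 * K * (W / (K * m)) = W / m * 3)%R; last first.
  by field; rewrite !gt_eqF.
rewrite EFinM -muleA; apply: le_trans (lee_wpmul2l _ QE); last first.
  by rewrite lee_fin divr_ge0 ?ltW.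
by rewrite mE -EFinM divfK ?gt_eqF// WE.
Qed.

Lemma A1_sufficient K : (0 < K)%R -> A1_bound K ->
  weak_bounded nu 1 (maximal omega beta mu).
Proof.
move=> K0 wF.
have fin Q : F Q -> mass nu Q < +oo.
  move=> FQ; have [m m0 mE] := F_real FQ; have [x Qx] := F_neq0 FQ.
  by apply: le_lt_trans (wF Q x FQ Qx) _; rewrite mE -EFinM ltry.
have K3 : (0 <= 3 * K)%R by rewrite mulr_ge0// ltW.
have [C C0 weak] := max_function_weak homega hmu beta4 nu0 K3 fin
  (A1_doubling K0 wF).
exists (K * C)%R; first by rewrite mulr_ge0// ltW.
move=> f _; apply: ge_ereal_sup => _ [t t0 <-].
pose g y := `|f y|%:E; have g0 y : 0 <= g y by rewrite lee_fin.
have tK : (0 <= t / K)%R by rewrite divr_ge0 ?ltW.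
have nuE y : 0 <= (nu y)%:E by rewrite lee_fin ltW.
rewrite /Lp_norm invr1 !poweRe1; [|
  by apply: esum_ge0 => y _; rewrite mule_ge0 ?poweR_ge0|by apply: esum_ge0].
have -> : \esum_(y in setT) (`|(EFin \o f) y| `^ 1 * (nu y)%:E) =
    \esum_(y in setT) (g y * (nu y)%:E).
  by apply: eq_esum => y _; rewrite poweRe1.
apply: (@le_trans _ _
    (K%:E * ((t / K)%:E * mass nu [set x | (t / K)%:E < Mx nu g x]))); last first.
  rewrite [(K * C)%:E]EFinM -[leRHS]muleA.
  by apply: lee_wpmul2l; [rewrite lee_fin ltW|exact: weak].
rewrite muleA -EFinM (_ : K * (t / K) = t)%R; last by field; rewrite gt_eqF.
apply: lee_wpmul2l; first by rewrite lee_fin ltW.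
apply: le_esum_set => // x /=; rewrite gee0_abs// (maximalE homega).
move=> /ereal_sup_gt[_ [i [vi Aix] <-]].
have FQ : F (trap_of omega i) by apply/(trapezoidsP homega); exists i.
have [m m0 mE] := F_real FQ; rewrite -/(mass mu _) mE => tm.
have W0 := mass_nu_gt0 Aix.
apply: (@lt_le_trans _ _ ((\esum_(y in trap_of omega i) (g y * (nu y)%:E)) /
    mass nu (trap_of omega i))); last by apply: ereal_sup_ubound; exists i.
rewrite lt_pdive ?fin//.
case WE : (mass nu (trap_of omega i)) (fin _ FQ) W0 => [W| |]// _; rewrite lte_fin => W0.
have le1 : (W / (K * m))%:E * (\esum_(y in trap_of omega i) (g y * (mu y)%:E)) <=
    \esum_(y in trap_of omega i) (g y * (nu y)%:E).
  rewrite -esumZl; last 2 first.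
  - by rewrite divr_ge0 ?mulr_ge0 ?ltW.
  - by move=> y _; rewrite mule_ge0// lee_fin ltW.
  apply: le_esum => y Ay; rewrite muleCA; apply: lee_wpmul2l => //.
  rewrite -EFinM lee_fin ler_wpM2r ?(ltW (mu0 y))//.
  have := wF _ y FQ Ay; rewrite WE mE -EFinM lee_fin => H.
  by rewrite ler_pdivrMr ?mulr_gt0// mulrA (mulrC (w y)).
apply: lt_le_trans le1.
rewrite lt_pdive ?lte_fin ?ltry// in tm.
rewrite (_ : (t / K)%:E * W%:E = (W / (K * m))%:E * (t%:E * m%:E)).
  by rewrite lte_pmul2l// lte_fin divr_gt0 ?mulr_gt0.
by rewrite -!EFinM; congr (_%:E); field; rewrite !gt_eqF.
Qed.

End Weak.
End Characterization.

Theorem corollary2p10 (R : realType) (T : tree) (omega : set (nat -> T))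
    (homega : boundary T omega) (o : T) (mu : T -> R)
    (hmu : flow_measure omega o mu) (beta : R) (hbeta : 12 <= beta)
    (w : T -> R) (hw : weight w) :
  (forall p : R, 1 < p ->
     (strong_bounded (fun y => w y * mu y) p (maximal omega beta mu) <->
      (Ap_const omega beta mu p w < +oo)%E)) /\
  (weak_bounded (fun y => w y * mu y) 1 (maximal omega beta mu) <->
   (A1_const omega beta mu w < +oo)%E).
Proof.
split=> [p p1|].
  split=> [bounded|Aoo].
    by apply/(Ap_constP homega hmu beta hw p1); exact: (Ap_necessary homega hmu).
  have [K K0 wA] := (Ap_constP homega hmu beta hw p1).1 Aoo.
  exact: (Ap_sufficient homega hmu hbeta hw p1 K0 wA).
split=> [bounded|Aoo].
  by apply/(A1_constP homega hmu beta hw); exact: (A1_necessary homega hmu).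
have [K K0 wA] := (A1_constP homega hmu beta hw).1 Aoo.
exact: (A1_sufficient homega hmu hbeta hw K0 wA).
Qed.
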